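(* Let $m\ge 2$. Then $\sigma(C_{2m+1},n)=\max\{2n+4m^2-6m,\ m(2n-m-1)\}+2$ for every $n\ge 2m+1$, and $\sigma(C_{2m+2},n)=\max\{2n+4m^2-2m-2,\ m(2n-m-1)+2\}+2$ for every $n\ge 2m+2$.
   Context: A sequence of nonnegative integers is graphic if it is the degree sequence of a simple graph; such a graph is a realization. $GS_n$ denotes the set of graphic sequences $(d_1,\ldots,d_n)$ with $d_1\ge\cdots\ge d_n\ge 0$ and $d_1\le n-1$. For $\pi=(d_1,\ldots,d_n)$, $\sigma(\pi)=d_1+\cdots+d_n$. A sequence $\pi\in GS_n$ is potentially $C_\ell$-graphic if some realization of $\pi$ contains the cycle $C_\ell$ of length $\ell$ as a subgraph. The potential number $\sigma(C_\ell,n)$ is the minimum even integer $s$ such that every $\pi\in GS_n$ with $\sigma(\pi)\ge s$ is potentially $C_\ell$-graphic. *)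

(* Defs.v *)
From mathcomp Require Import all_boot.

Set Implicit Arguments.
Unset Strict Implicit.
Unset Printing Implicit Defensive.

Definition simple_graph (T : finType) (e : rel T) : Prop :=
  symmetric e /\ irreflexive e.

Definition degree (T : finType) (e : rel T) (x : T) : nat := #|[set y | e x y]|.

Definition realization (n : nat) (d : n.-tuple nat) (e : rel 'I_n) : Prop :=
  simple_graph e /\ forall i : 'I_n, degree e i = tnth d i.

Definition graphic (n : nat) (d : n.-tuple nat) : Prop :=
  exists e : rel 'I_n, realization d e.

Definition GS (n : nat) (d : n.-tuple nat) : Prop :=
  [/\ graphic d, sorted geq d & head 0 d <= n.-1].

(* [ucycle e c] says that the vertices listed in [c] are distinct and
   cyclically adjacent. For [l <= 2] this does not describe a cycle of a simple
   graph, hence the explicit bound. *)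
Definition contains_cycle (T : finType) (e : rel T) (l : nat) : Prop :=
  2 < l /\ exists c : seq T, ucycle e c /\ size c = l.

Definition potentially_cycle_graphic (l n : nat) (d : n.-tuple nat) : Prop :=
  exists e : rel 'I_n, realization d e /\ contains_cycle e l.

Definition forces_cycle (l n s : nat) : Prop :=
  forall d : n.-tuple nat,
    GS d -> s <= sumn d -> potentially_cycle_graphic l d.

(* [is_potential_number l n s] is "sigma(C_l, n) = s". Ranging over [nat] loses
   nothing: for [3 <= l] and [1 <= n] the zero sequence is in GS_n and is not
   potentially C_l-graphic, so no [s <= 0] forces C_l. *)
Definition is_potential_number (l n s : nat) : Prop :=
  [/\ ~~ odd s, forces_cycle l n s
    & forall s' : nat, ~~ odd s' -> forces_cycle l n s' -> s <= s'].

(* Main.v *)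
Require Import Defs.
From mathcomp Require Import all_boot.
From mathcomp Require Import zify.
From Stdlib Require Import Classical.

Set Implicit Arguments.
Unset Strict Implicit.
Unset Printing Implicit Defensive.

(** Among the graphs with a given degree sequence we move by 2-switches, which
    replace two edges [ab], [cd] by two non-edges [ac], [bd].

    Shortening: if no switch shortens a cycle [C], then neighbouring vertices of
    [C] can be transposed freely, so any chord, and any two vertices with
    neighbours outside [C], can be brought to the distance at which they do
    shorten [C]. Lengthening: a cycle disjoint from [C] can be merged into [C];
    if there is none, the ends of a longest path outside [C] have almost all
    their neighbours on [C], which forces [C] to be long when the minimum degree
    exceeds [m]. Together these give C_l whenever all degrees exceed [m].

    Otherwise remove a vertex of minimum degree, after switching so that its
    neighbours are vertices of largest degree. The invariants are the Posa
    condition "for 1 <= a <= m at least l + 1 - a vertices have degree > a",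
    which follows from the bound on the degree sum because the sums of the
    threshold sequences ((n-1)^a, (l-a-1)^(l-2a), a^(n-l+a)) are convex in [a],
    and the bound m(2n-m-1) on the degree sum. The induction ends at n = l with
    Posa's theorem. The threshold sequences with a = 1 and a = m are extremal. *)

(** * Switching *)

(** The vertices are labelled, so for a simple [e] this says that [e'] is another realization of the
    same degree sequence. *)
Definition rewires (T : finType) (e e' : rel T) : Prop :=
  simple_graph e' /\ forall x, degree e' x = degree e x.

(** The four pairs between {a, d} and {b, c} are toggled: under the hypotheses of [switch_rewires]
    the edges [ab], [cd] disappear and [ac], [bd] appear. *)
Definition switch (T : finType) (e : rel T) (a b c d : T) : rel T :=
  fun x y => e x y (+)
    ((x \in [:: a; d]) && (y \in [:: b; c]) ||
     (x \in [:: b; c]) && (y \in [:: a; d])).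

Section Switching.

Variable T : finType.
Implicit Types (e : rel T) (s r C : seq T) (a b c d x y z u v w : T).

Lemma rewires_refl e : simple_graph e -> rewires e e.
Proof. by move=> ?; split. Qed.

Lemma rewires_trans e1 e2 e3 : rewires e1 e2 -> rewires e2 e3 -> rewires e1 e3.
Proof. by move=> [_ d12] [s3 d23]; split=> // x; rewrite d23 d12. Qed.

Lemma degree_toggle e e' x y z : e x y -> ~~ e x z ->
  (forall w, e' x w = e x w (+) (w \in [:: y; z])) -> degree e' x = degree e x.
Proof.
move=> xy nxz e'E.
have nyz : y != z by apply: contraNneq nxz => <-.
rewrite /degree.
have -> : [set w | e' x w] = z |: ([set w | e x w] :\ y).
  apply/setP=> w; rewrite !inE e'E !inE.
  have [->|/=] := eqVneq w y; first by rewrite xy (negbTE nyz).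
  by have [->|/=] := eqVneq w z; rewrite ?(negbTE nxz) ?addbF.
rewrite cardsU1 !inE (negbTE nxz) andbF /= (cardsD1 y [set w | e x w]).
by rewrite inE xy.
Qed.

(** Each of the four vertices loses one neighbour and gains one. A coincidence [a = d] or [b = c]
    would turn an edge into the non-edge [ac], so all four are distinct. *)
Lemma switch_rewires e a b c d : simple_graph e ->
  e a b -> e c d -> ~~ e a c -> ~~ e b d -> a != c -> b != d ->
  rewires e (switch e a b c d).
Proof.
move=> [sym irr] ab cd nac nbd neac nebd.
have neab : a != b by apply: contraTneq ab => ->; rewrite irr.
have necd : c != d by apply: contraTneq cd => ->; rewrite irr.
have nead : a != d by apply: contraNneq nac => ->; rewrite sym.
have nebc : b != c by apply: contraNneq nac => <-.
split; first split.
- by move=> x y; rewrite /switch sym orbC andbC [X in _ || X]andbC.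
- move=> x; rewrite /switch irr /= !inE.
  have [->|_] := eqVneq x a; first by rewrite (negbTE neab) (negbTE neac).
  have [->|_] := eqVneq x d; last by rewrite /= andbF.
  by rewrite eq_sym (negbTE nebd) eq_sym (negbTE necd).
move=> x.
have [->|nxa] := eqVneq x a.
  apply: (degree_toggle ab nac) => w.
  by rewrite /switch !inE eqxx (negbTE neab) (negbTE neac) /= orbF.
have [->|nxd] := eqVneq x d.
  apply: (@degree_toggle _ _ _ c b); rewrite 1?sym //.
  move=> w; rewrite /switch !inE eqxx orbT [d == b]eq_sym [d == c]eq_sym.
  by rewrite (negbTE nebd) (negbTE necd) /= orbF [X in _ (+) X]orbC.
have [->|nxb] := eqVneq x b.
  apply: (@degree_toggle _ _ _ a d); rewrite 1?sym //.
    by rewrite sym.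
  move=> w; rewrite /switch !inE eqxx [b == a]eq_sym.
  by rewrite (negbTE nebd) (negbTE neab) /=.
have [->|nxc] := eqVneq x c.
  apply: (@degree_toggle _ _ _ d a); rewrite 1?sym //.
    by rewrite sym.
  move=> w; rewrite /switch !inE eqxx [c == a]eq_sym orbT.
  by rewrite (negbTE neac) (negbTE necd) /= [X in _ (+) X]orbC.
apply: eq_card => w; rewrite !inE /switch !inE.
by rewrite (negbTE nxa) (negbTE nxb) (negbTE nxc) (negbTE nxd) addbF.
Qed.

Lemma ucycle_catC e s1 s2 : ucycle e (s1 ++ s2) -> ucycle e (s2 ++ s1).
Proof. by rewrite -rot_size_cat rot_ucycle. Qed.

Lemma cycle_split e x s y r :
  cycle e (x :: s ++ y :: r) = path e x (rcons s y) && path e y (rcons r x).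
Proof. by rewrite /= rcons_cat /= -cat_rcons cat_path last_rcons. Qed.

Lemma switchE_out e a b c d x y :
  (x \notin [:: b; c]) -> (y \notin [:: b; c]) -> switch e a b c d x y = e x y.
Proof.
by rewrite /switch => /negbTE -> /negbTE ->; rewrite andbF addbF.
Qed.

(** Every toggled pair has an end in {b, c}. *)
Lemma path_switch e a b c d x s :
  b \notin x :: s -> c \notin x :: s ->
  path (switch e a b c d) x s = path e x s.
Proof.
move=> hb hc; apply: (@eq_in_path _ [pred y | y \notin [:: b; c]]).
  by move=> y z /= hy hz; rewrite switchE_out.
apply/allP=> y ys /=; rewrite !inE negb_or.
by apply/andP; split; [apply: contraNneq hb | apply: contraNneq hc] => <-.
Qed.

End Switching.

(** * Shortening a cycle *)

Definition realizes_cycle (T : finType) (e : rel T) (l : nat) : Prop :=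
  exists e' (C : seq T), [/\ rewires e e', ucycle e' C & size C = l].

Section Shortening.

Variable T : finType.
Implicit Types (e : rel T) (p q s r C : seq T) (a b c d x y z u v w : T).

Lemma realizes_cycle_rewires e e' l :
  rewires e e' -> realizes_cycle e' l -> realizes_cycle e l.
Proof.
by move=> ee' [f [C [e'f uC sC]]]; exists f, C; split=> //; apply: rewires_trans e'f.
Qed.

Lemma detour e x s y r :
  path e x (rcons s y) -> path e y (rcons r x) -> uniq (x :: s ++ y :: r) ->
  ucycle e (x :: s ++ y :: r).
Proof. by move=> h1 h2 h3; rewrite /ucycle cycle_split h1 h2. Qed.

(** Used with [s] empty for a chord, and with [s] nonempty for an excursion outside the cycle. *)
Lemma ucycle_detour e x q y r s :
  ucycle e (x :: q ++ y :: r) -> path e x (rcons s y) -> uniq s ->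
  ~~ has [in x :: q ++ y :: r] s -> ucycle e (x :: s ++ y :: r).
Proof.
move=> /andP[]; rewrite cycle_split => /andP[_ h2] uC h1 us hs.
apply: detour => //; move: uC; rewrite /= !mem_cat !cat_uniq /=.
case/and5P; rewrite negb_or => /andP[_ xyr] uq _ yr ur.
move: hs; rewrite has_sym /= negb_or has_cat /= !negb_or => /andP[xs /and3P[_ ys rs]].
by move: xyr; rewrite inE negb_or xs us ys rs yr ur => /andP[-> ->].
Qed.

(** Neither [uw] nor [vz] is an edge, since it would bypass one vertex. Hence [uv], [wz] can be
    switched to [uw], [vz], which exchanges [v] and [w] on the cycle. The last two clauses record
    which adjacencies survive: those of outside vertices, and those of [w] except with [u] and
    [z]. *)
Lemma transpose_cycle e u v w z r : simple_graph e ->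
  ucycle e [:: u, v, w, z & r] -> ~ realizes_cycle e (size r).+3 ->
  exists e', [/\ rewires e e', ucycle e' [:: u, w, v, z & r],
    forall x y, x \notin [:: u, v, w, z & r] -> e' x y = e x y
    & forall x, x != u -> x != z -> e' x w = e x w].
Proof.
move=> se uC noshort; have [sym irr] := se.
have nuw : ~~ e u w.
  apply/negP=> uw; apply: noshort; exists e, [:: u, w, z & r].
  split=> //.
  by apply: (@ucycle_detour e u [:: v] w (z :: r) [::]) => //=; rewrite uw.
have nvz : ~~ e v z.
  apply/negP=> vz; apply: noshort; exists e, [:: u, v, z & r].
  split=> //.
  move: uC; rewrite -[_ :: _]/([:: u] ++ [:: v, w, z & r]) => /ucycle_catC uC.
  apply: (@ucycle_catC _ _ [:: v, z & r] [:: u]) => /=.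
  by apply: (@ucycle_detour e v [:: w] z (r ++ [:: u]) [::]) => //=; rewrite vz.
have /andP[] := uC; rewrite /= => /and4P[uv vw wz pz].
rewrite !inE !negb_or => /and5P[/and4P[nuv nuw' nuz ur] /and3P[nvw nvz' vr]].
move=> /andP[nwz wr] zr unr.
have rw := switch_rewires se uv wz nuw nvz nuw' nvz'.
exists (switch e u v w z); split=> //.
- rewrite /ucycle /= path_switch ?pz; last 2 first.
  + by rewrite inE mem_rcons inE !negb_or nvz' eq_sym nuv vr.
  + by rewrite inE mem_rcons inE !negb_or nwz eq_sym nuw' wr.
  have neqs := (negbTE nuv, negbTE nuw', negbTE nuz, negbTE nvw, negbTE nvz', negbTE nwz).
  have eqs := (eq_sym v u, eq_sym w u, eq_sym z u, eq_sym w v, eq_sym z v, eq_sym z w).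
  rewrite /switch !inE !eqs !neqs !eqxx (negbTE nuw) (negbTE nvz) sym vw /=.
  by rewrite ur wr vr zr unr.
- move=> x y; rewrite !inE !negb_or => /and5P[xu xv xw xz _].
  by rewrite /switch !inE (negbTE xu) (negbTE xv) (negbTE xw) (negbTE xz) addbF.
- move=> x xu xz; rewrite /switch !inE (negbTE xu) (negbTE xz) eqxx orbT /=.
  by rewrite (eq_sym w) (negbTE nuw') (negbTE nwz) andbF addbF.
Qed.

(** Transposing [v] and [w] moves [w] one place towards [x]. If neither cyclic neighbour of the pair
    is [x], the adjacency of [x] and [w] is kept. *)
Lemma step_left e x p v w q : simple_graph e ->
  ucycle e (x :: rcons p v ++ w :: q) -> 0 < size p + size q ->
  ~ realizes_cycle e (size p + size q).+2 ->
  exists e', [/\ rewires e e', ucycle e' (x :: p ++ [:: w, v & q]),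
    forall y z, y \notin x :: rcons p v ++ w :: q -> e' y z = e y z
    & p != [::] -> q != [::] -> e' x w = e x w].
Proof.
move=> se uC hpq noshort.
(* [u] precedes [v] on the cycle; it is [x] itself when [p] is empty. *)
have [p0 [u pE]] : exists p0 u, x :: p = rcons p0 u.
  by case/lastP: (p) => [|p' u]; [exists [::], x | exists (x :: p'), u].
have CE : x :: rcons p v ++ w :: q = p0 ++ [:: u, v, w & q].
  by rewrite cat_rcons -cat_cons pE cat_rcons.
have szp : size p = size p0 by have := congr1 size pE; rewrite size_rcons => -[].
have mC y : (y \in x :: rcons p v ++ w :: q) = (y \in [:: u, v, w & q ++ p0]).
  by rewrite CE -!cat_cons !mem_cat orbC.
have : ucycle e ([:: u, v, w & q] ++ p0) by apply: ucycle_catC; rewrite -CE.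
(* [z] follows [w] cyclically; it differs from [u], [v], [w] because the cycle has at least four
   vertices. *)
case qpE: (q ++ p0) => [|z r].
  by have := congr1 size qpE; rewrite size_cat /=; lia.
have szr : (size r).+1 = size p + size q.
  by have := congr1 size qpE; rewrite size_cat /=; lia.
rewrite /= qpE => uC'.
have [|e' [rw uC2 out xw]] := transpose_cycle se uC'.
  by rewrite [X in X.+2]szr.
exists e'; split=> //.
- rewrite -cat_cons pE cat_rcons; apply: (@ucycle_catC _ _ [:: u, w, v & q]).
  by rewrite /= qpE.
- by move=> y y' yC; apply: out; rewrite -qpE -mC.
move=> pn qn; case/andP: uC => _ /=.
rewrite mem_cat mem_rcons !inE !negb_or => /andP[/andP[/andP[_ xp] /andP[_ xq]] _].
apply: xw.
  case/lastP: p pE pn xp {mC CE hpq noshort szp szr} => // p' u'.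
  rewrite -rcons_cons => /rcons_inj[_ <-] _; rewrite mem_rcons inE negb_or.
  by case/andP.
case: q qpE qn xq {mC CE hpq noshort uC' szr} => // z' q' /= [-> _] _.
by rewrite inE negb_or => /andP[].
Qed.

(** Moving [w] towards [x] preserves the chord [xw], until it bypasses a single vertex or some step
    already yields a shorter cycle. *)
Lemma chord_shortens e x p w q : simple_graph e ->
  ucycle e (x :: p ++ w :: q) -> p != [::] -> q != [::] -> e x w ->
  realizes_cycle e (size p + size q).+1.
Proof.
have [n] := ubnP (size p); elim: n => // n IH in e p q *.
case/lastP: p => // p v; rewrite size_rcons ltnS => szn se uC _ qn xw.
case: (eqVneq p [::]) szn uC => [->|pn] szn uC.
  exists e, (x :: w :: q); split=> //.
  apply: (@ucycle_detour e x [:: v] w q [::]) => //=; by rewrite xw.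
apply: NNPP => noshort.
have szq : 0 < size q by case: (q) qn.
have [||e' [rw uC2 _ xwE]] := step_left se uC; [lia | by rewrite addSn in noshort |].
apply: noshort; rewrite addSnnS; apply: (realizes_cycle_rewires rw).
by apply: (IH e' p (v :: q)) => //; [case: rw | rewrite xwE].
Qed.

Lemma arrange_left e x p w q k : simple_graph e ->
  ucycle e (x :: p ++ w :: q) -> 1 < size p + size q -> k <= size p ->
  ~ realizes_cycle e (size p + size q).+1 ->
  exists e' p' q', [/\ rewires e e', ucycle e' (x :: p' ++ w :: q'),
    size p' = k /\ size p' + size q' = size p + size q,
    x :: p ++ w :: q =i x :: p' ++ w :: q'
    & forall y z, y \notin x :: p ++ w :: q -> e' y z = e y z].
Proof.
elim/last_ind: p => [|p v IH] in e q * => se uC szpq hk noshort.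
  by move: hk; rewrite leqn0 => /eqP->; exists e, [::], q; split.
move: hk; rewrite leq_eqVlt => /predU1P[->|].
  by exists e, (rcons p v), q; split.
rewrite size_rcons ltnS => hk; rewrite size_rcons in szpq noshort.
have [||e1 [rw1 uC1 out1 _]] := step_left se uC; [lia | by rewrite addSn in noshort |].
have mC : x :: rcons p v ++ w :: q =i x :: p ++ [:: w, v & q].
  by move=> y; rewrite !inE !mem_cat mem_rcons !inE; do !case: eqP => //=; rewrite ?orbT.
have [|||e2 [p' [q' [rw2 uC2 [sz1 sz2] mC2 out2]]]] := IH e1 (v :: q) _ uC1 _ hk.
- by case: rw1.
- by rewrite /=; lia.
- by rewrite /= addnS -addSn => /(realizes_cycle_rewires rw1).
exists e2, p', q'; split=> //.
- exact: rewires_trans rw2.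
- by split=> //; rewrite sz2 /= ?size_rcons; lia.
- by move=> y; rewrite mC mC2.
- by move=> y z yC; rewrite out2 -?mC // out1.
Qed.

(** [arrange_left] can only decrease the gap, so [w] is first brought next to [x], and the gap is
    then opened from the other side. *)
Lemma arrange e C x w k : simple_graph e -> ucycle e C -> 3 < size C ->
  x \in C -> w \in C -> x != w -> k.+1 < size C ->
  ~ realizes_cycle e (size C).-1 ->
  exists e' p q, [/\ rewires e e', ucycle e' (x :: p ++ w :: q),
    size p = k /\ size p + size q = (size C).-2,
    C =i x :: p ++ w :: q
    & forall y z, y \notin C -> e' y z = e y z].
Proof.
move=> se uC szC xC wC nxw hk noshort.
have [i C1 C1E] := rot_to xC.
have mC : C =i x :: C1 by move=> y; rewrite -C1E mem_rot.
have wC1 : w \in C1 by move: wC; rewrite mC inE eq_sym (negbTE nxw).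
case/splitPr: wC1 C1E mC => p q C1E mC.
have sz : size C = (size p + size q).+2.
  by rewrite -(size_rot i) C1E /= size_cat /= addnS.
have uC1 : ucycle e (x :: p ++ w :: q) by rewrite -C1E rot_ucycle.
rewrite sz /= in hk noshort szC *.
have [|e1 [p1 [q1 [rw1 uC2 [s1 s2] mC1 out1]]]] := arrange_left (k := 0) se uC1 _ (leq0n _) noshort.
  by lia.
case: p1 s1 => // _ in uC2 s2 mC1; rewrite /= add0n in s2 uC2 mC1.
have /ucycle_catC /= uC3 : ucycle e1 ([:: x] ++ w :: q1) by [].
rewrite /= in uC3; have se1 : simple_graph e1 by case: rw1.
have mC2 : x :: w :: q1 =i w :: q1 ++ [:: x].
  by move=> y; rewrite !inE mem_cat inE; case: (y == x); rewrite ?orbT ?orbF.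
(* Read from [w], the cycle ends in [x]. Moving [x] left until [size q1 - k] vertices precede it
   leaves [k] vertices from [x] round to [w]. *)
have [|||e2 [p2 [q2 [rw2 uC4 [s3 s4] mC3 out2]]]] :=
  arrange_left (k := size q1 - k) se1 uC3.
- by rewrite /=; lia.
- by rewrite leq_subr.
- by rewrite /= addn0 s2 => /(realizes_cycle_rewires rw1).
exists e2, q2, p2; split.
- exact: rewires_trans rw2.
- by apply: (@ucycle_catC _ _ (w :: p2) (x :: q2)).
- by move: s4 => /=; lia.
- move=> y; rewrite mC mC1 mC2 mC3.
  by rewrite -[w :: p2 ++ _]cat_cons -[x :: q2 ++ _]cat_cons !mem_cat orbC.
- move=> y z yC; rewrite out2; last by rewrite -mC2 -mC1 -mC.
  by rewrite out1 // -mC.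
Qed.

(** If no shortening exists, every vertex of [C] has a neighbour outside. Two vertices of [C] are
    then placed at a distance that suits their outside neighbours. *)
Lemma cycle_shorten e C : simple_graph e -> (forall x, 2 < degree e x) ->
  ucycle e C -> 5 < size C -> realizes_cycle e (size C).-1.
Proof.
move=> se deg3 uC szC; apply: NNPP => noshort.
(* A third neighbour lying on the cycle would give a chord. *)
have nbr e1 (C1 : seq T) x : rewires e e1 -> ucycle e1 C1 -> size C1 = size C -> x \in C1 ->
  exists2 y, e1 x y & y \notin C1.
  move=> rw1 uC1 sz xC1; apply: NNPP => none.
  have [se1 d1] := rw1; have [sym irr] := se1.
  have [i C2 C2E] := rot_to xC1.
  case: C2 C2E => [|v C2] C2E.
    by have := congr1 size C2E; rewrite size_rot /= sz; lia.
  case/lastP: C2 C2E => [|C2 z] C2E.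
    by have := congr1 size C2E; rewrite size_rot /= sz; lia.
  have [w xw wn] : exists2 w, e1 x w & w \notin [:: v; z].
    apply: NNPP => h.
    have sub : [set y | e1 x y] \subset [:: v; z].
      apply/subsetP=> y; rewrite inE => xy; apply: NNPP => /negP yn.
      by apply: h; exists y.
    have := deg3 x; rewrite -d1 => dx.
    by have := leq_trans dx (leq_trans (subset_leq_card sub) (card_size _)).
  have wC : w \in C1 by apply: NNPP => /negP h; apply: none; exists w.
  have wC2 : w \in C2.
    move: wC wn; rewrite -(mem_rot i) C2E !inE mem_rcons inE.
    by case: eqVneq xw => [->|_]; rewrite ?irr //; case: (w == v); case: (w == z).
  case/splitPr: wC2 C2E => p q C2E.
  apply: noshort.
  have -> : (size C).-1 = (size (v :: p) + size (rcons q z)).+1.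
    by rewrite -sz -(size_rot i) C2E /= size_rcons size_cat /= size_rcons; lia.
  apply: (realizes_cycle_rewires rw1).
  apply: (@chord_shortens e1 x (v :: p) w (rcons q z)) => //; last by case: (q).
  by rewrite -(rot_ucycle i) C2E in uC1; rewrite /= -rcons_cons -rcons_cat.
case CE: C => [|x [|w C']]; [by rewrite CE in szC | by rewrite CE in szC|].
have xC : x \in C by rewrite CE inE eqxx.
have wC : w \in C by rewrite CE !inE eqxx orbT.
have nxw : x != w by case/andP: uC => _; rewrite CE /= inE negb_or => /andP[/andP[]].
have [y xy yC] := nbr _ _ _ (rewires_refl se) uC (erefl _) xC.
have [y' wy' y'C] := nbr _ _ _ (rewires_refl se) uC (erefl _) wC.
have [sym irr] := se.
have arr k (hk : k.+1 < size C) := arrange se uC (ltnW (ltnW szC)) xC wC nxw hk noshort.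
have sgo e1 (C1 : seq T) : rewires e e1 -> ucycle e1 C1 -> size C1 = (size C).-1 -> False.
  by move=> *; apply: noshort; exists e1, C1.
(* A common outside neighbour replaces two vertices of the cycle. *)
have [yy'|nyy'] := eqVneq y y'.
  have [|e1 [p [q [rw1 uC1 [s1 s2] mC out]]]] := arr 2; first by lia.
  have [[sym1 _] _] := rw1.
  apply: (sgo e1 (x :: [:: y] ++ w :: q) rw1); last by move=> /=; lia.
  apply: (ucycle_detour uC1) => //=; last by rewrite -mC (negbTE yC).
  by rewrite sym1 !out // sym xy yy' sym wy'.
(* Two adjacent outside neighbours replace three vertices. *)
have [eyy'|neyy'] := boolP (e y y').
  have [|e1 [p [q [rw1 uC1 [s1 s2] mC out]]]] := arr 3; first by lia.
  have [[sym1 _] _] := rw1.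
  apply: (sgo e1 (x :: [:: y; y'] ++ w :: q) rw1); last by move=> /=; lia.
  apply: (ucycle_detour uC1) => //=; last first.
  - by rewrite -!mC (negbTE yC) (negbTE y'C).
  - by rewrite inE nyy'.
  by rewrite sym1 !out // sym xy eyy' sym wy'.
(* Otherwise switch [xy], [wy'] to [xw], [yy']: with one vertex between [x] and [w], the new edge
   [xw] is a chord. *)
have [|e1 [p [q [rw1 uC1 [s1 s2] mC out]]]] := arr 1; first by lia.
have [se1 _] := rw1; have [sym1 irr1] := se1.
have szpq : (size p + size q).+1 = (size C).-1 by lia.
have pn : p != [::] by case: (p) s1.
have qn : q != [::] by apply: contraTneq szC => qE; rewrite qE /= in s2; lia.
have nxw1 : ~~ e1 x w.
  apply/negP=> xw; apply: noshort; rewrite -szpq.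
  by apply: (realizes_cycle_rewires rw1); apply: chord_shortens uC1 _ _ _.
have xy1 : e1 x y by rewrite sym1 out // sym.
have wy1 : e1 w y' by rewrite sym1 out // sym.
have rw2 : rewires e1 (switch e1 x y w y').
  by apply: switch_rewires => //; rewrite out.
apply: noshort; rewrite -szpq.
apply: (realizes_cycle_rewires rw1); apply: (realizes_cycle_rewires rw2).
apply: (@chord_shortens _ x p w q) => //; first by case: rw2.
  case/andP: uC1 => c1 u1; rewrite /ucycle u1 andbT.
  apply: (@sub_in_cycle _ [in C] e1) c1; last first.
    by apply/allP=> a; rewrite /= -mC.
  move=> a b aC bC ab; rewrite /switch ab !inE.
  have ne a' y0 : a' \in C -> y0 \notin C -> (a' == y0) = false.
    by move=> h1 h2; apply: contraNF h2 => /eqP<-.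
  rewrite (ne a y) // (ne a y') // (ne b y) // (ne b y') // !orbF /=.
  apply/norP; split; apply/negP=> /andP[/eqP aE /eqP bE].
    by rewrite aE bE (negbTE nxw1) in ab.
  by rewrite aE bE sym1 (negbTE nxw1) in ab.
by rewrite /switch (negbTE nxw1) !inE !eqxx orbT.
Qed.

End Shortening.

(** * Lengthening a cycle *)

Definition realizes_longer (T : finType) (e : rel T) (l : nat) : Prop :=
  exists2 n, l < n & realizes_cycle e n.

Section Lengthening.

Variable T : finType.
Implicit Types (e : rel T) (p q s r C D : seq T) (a b c d x y z u v w t : T).

(** The start [x] may itself be one of the switched vertices, because its successor [t] is not. *)
Lemma path_switch_cons e a b c d x t s :
  t \notin [:: a; b; c; d] -> b \notin s -> c \notin s ->
  path (switch e a b c d) x (t :: s) = path e x (t :: s).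
Proof.
rewrite !inE !negb_or => /and4P[ta tb tc td] bs cs.
rewrite /= path_switch ?inE ?negb_or; last 2 first.
- by rewrite eq_sym tb.
- by rewrite eq_sym tc.
by rewrite /switch !inE (negbTE ta) (negbTE tb) (negbTE tc) (negbTE td) !andbF addbF.
Qed.

Lemma ucycle_rev e C : symmetric e -> ucycle e C -> ucycle e (rev C).
Proof.
move=> sym /andP[cC uC]; rewrite /ucycle rev_uniq uC andbT rev_cycle.
by rewrite (eq_cycle (e' := e)) // => x y; rewrite sym.
Qed.

Lemma path_rev e x s y : symmetric e ->
  path e x (rcons s y) -> path e y (rcons (rev s) x).
Proof.
move=> sym h; have := rev_path e x (rcons s y).
rewrite last_rcons belast_rcons rev_cons => ->.
by rewrite (eq_path (e' := e)) // => u v; rewrite sym.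
Qed.

(** Switching [x1 x2], [y z] to [x1 y], [x2 z] joins the two cycles into one, which runs through the
    second cycle backwards from [y] to [z]. *)
Lemma merge_switch e x1 x2 x3 r y z t q : simple_graph e ->
  ucycle e [:: x1, x2, x3 & r] -> ucycle e (y :: z :: rcons q t) ->
  ~~ has [in [:: x1, x2, x3 & r]] (y :: z :: rcons q t) ->
  ~~ e x1 y -> ~~ e x2 z -> realizes_longer e (size r).+3.
Proof.
move=> se uC uD dis nx1y nx2z; have [sym irr] := se.
have [/andP[cC unC] /andP[cD unD]] := (uC, uD).
have /andP[x12 /andP[x23 pC]] : e x1 x2 && (e x2 x3 && path e x3 (rcons r x1)) := cC.
have /andP[yz pD] : e y z && path e z (rcons (rcons q t) y) := cD.
have nmem u v : u \in [:: x1, x2, x3 & r] -> v \in y :: z :: rcons q t -> u != v.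
  by move=> uC' vD; apply: contraNneq dis => uv; apply/hasP; exists v => //; rewrite -uv.
have x1y : x1 != y by apply: nmem; rewrite !inE eqxx.
have x2z : x2 != z by apply: nmem; rewrite !inE eqxx ?orbT.
have rw := switch_rewires se x12 yz nx1y nx2z x1y x2z.
set e' := switch e x1 x2 y z in rw; have [[sym' _] _] := rw.
have {}pD : path e y (t :: rcons (rev q) z).
  by have := path_rev sym pD; rewrite rev_rcons.
exists (size r + size q).+2.+4; first by clear; lia.
exists e', (x1 :: rcons (y :: t :: rev q) z ++ [:: x2, x3 & r]); split=> //; last first.
  by rewrite /= size_cat size_rcons /= size_rev; clear; lia.
have sE : rcons (y :: t :: rev q) z = rev (rcons (z :: rcons q t) y).
  by rewrite rev_rcons rev_cons rev_rcons.
have mC u v : u \in [:: x1, x2, x3 & r] -> v \in y :: z :: rcons q t -> (u == v) = false.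
  by move=> ? ?; apply/negbTE/nmem.
have CD u : u \in [:: x1, x2, x3 & r] -> u \notin y :: z :: rcons q t.
  by move=> uC'; apply/negP=> /(nmem _ _ uC'); rewrite eqxx.
have := unD; rewrite /= !inE !mem_rcons !inE !negb_or rcons_uniq.
case/and4P=> /and3P[_ yt yq] /andP[zt zq] _ _.
have := unC; rewrite /= !inE !negb_or.
case/and4P=> /and3P[_ x13 x1r] /andP[nx23 x2r] _ _.
apply: (@detour _ e' x1 (rcons (y :: t :: rev q) z) x2 (x3 :: r)).
- rewrite rcons_path last_rcons /= -/e'.
  have -> : e' x1 y by rewrite /e' /switch (negbTE nx1y) !inE !eqxx orbT.
  have -> : e' z x2.
    by rewrite sym' /e' /switch (negbTE nx2z) !inE !eqxx orbT [_ && true]andbT orbT.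
  rewrite andbT; have := pD; rewrite /e' -(@path_switch_cons _ x1 x2 y z) //.
  + rewrite !inE !(eq_sym t) (negbTE yt) (negbTE zt).
    by rewrite !mC // !inE ?eqxx ?mem_rcons ?inE ?eqxx ?orbT.
  + have := @CD x2; rewrite !inE !mem_rcons !inE mem_rev !negb_or eqxx orbT.
    by case/(_ isT)/and4P=> _ -> _ ->.
  + by rewrite mem_rcons inE mem_rev negb_or yq andbT; apply: contraTneq yz => ->; rewrite irr.
- rewrite /= -/e'; have : path e x2 (x3 :: rcons r x1) by rewrite /= x23.
  rewrite -(@path_switch_cons _ x1 x2 y z) //.
  + rewrite !inE (eq_sym x3 x1) (eq_sym x3 x2) (negbTE x13) (negbTE nx23).
    by rewrite !mC // !inE ?eqxx ?mem_rcons ?inE ?eqxx ?orbT.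
  + by rewrite mem_rcons inE negb_or x2r andbT; apply: contraTneq x12 => ->; rewrite irr.
  + apply/negP=> h; have := @CD y; rewrite !inE eqxx; move: h.
    by rewrite mem_rcons inE => /orP[|] ->; rewrite ?orbT => /(_ isT).
have uS : uniq (rev (rcons (z :: rcons q t) y)) by rewrite rev_uniq rcons_uniq.
rewrite -cat1s uniq_catCA sE cat_uniq uS cat1s unC andbT andTb; apply/hasPn=> u uC'.
change (u \notin rev (rcons (z :: rcons q t) y)); rewrite mem_rev mem_rcons; exact: CD.
Qed.

Lemma ucycle_detour_realizes e x q y r s : simple_graph e ->
  ucycle e (x :: q ++ y :: r) -> path e x (rcons s y) -> uniq s ->
  ~~ has [in x :: q ++ y :: r] s -> realizes_cycle e (size s + size r).+2.
Proof.
move=> se uC ps us dis; exists e, (x :: s ++ y :: r).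
by split; [| apply: ucycle_detour uC _ _ _ | rewrite /= size_cat /= addnS].
Qed.

(* A cycle [D] disjoint from [C] is merged into [C] by a switch, unless every
   edge of [C] has exactly one end adjacent to both ends of an edge of [D];
   then two vertices at distance two on [C] admit a detour through [D]. *)
Lemma disjoint_cycle_longer e C D : simple_graph e ->
  ucycle e C -> 2 < size C -> ucycle e D -> 2 < size D ->
  ~~ has [in C] D -> realizes_longer e (size C).
Proof.
move=> se uC szC uD szD dis; apply: NNPP => nolong; have [sym irr] := se.
case: D uD szD dis => [|y [|z q]] // uD szD dis.
case/lastP: q uD szD dis => [|q t] // uD _ dis.
have /andP[/andP[yz _] unD] : cycle e (y :: z :: rcons q t) && uniq (y :: z :: rcons q t) := uD.
have nyz : y != z by move: unD; rewrite /= inE negb_or => /andP[/andP[]].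
pose b x := e x y && e x z.
have alt x1 x2 x3 r (C1 := [:: x1, x2, x3 & r]) : ucycle e C1 -> size C1 = size C -> C1 =i C ->
    b x1 (+) b x2 /\ ~~ (b x1 && b x3).
  move=> uC1 sz1 mC1.
  have dis1 : ~~ has [in C1] (y :: z :: rcons q t) by rewrite (eq_has mC1).
  have yC1 : y \notin C1 by move: dis1; rewrite [has _ _]/= negb_or => /andP[].
  have zC1 : z \notin C1 by move: dis1; rewrite [has _ _]/= !negb_or => /and3P[].
  have ins s : path e x1 (rcons s x2) -> uniq s -> ~~ has [in C1] s -> 0 < size s -> False.
    move=> ps us ds s0; apply: nolong; exists (size s + size (x3 :: r)).+2.
      by rewrite -sz1 /=; clear -s0; lia.
    exact: (@ucycle_detour_realizes e x1 [::] x2 (x3 :: r) s se uC1).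
  have ndet : ~~ (b x1 && b x3).
    apply/negP=> /andP[/andP[x1y _] /andP[_ x3z]]; apply: nolong.
    exists (size [:: y; z] + size r).+2; first by rewrite -sz1 /=.
    apply: (@ucycle_detour_realizes e x1 [:: x2] x3 r [:: y; z] se uC1) => /=.
    - by rewrite x1y yz sym x3z.
    - by rewrite inE nyz.
    - by rewrite (negbTE yC1) (negbTE zC1).
  split=> //.
  have n1 : ~~ (e x1 y && e x2 y).
    apply/negP=> /andP[h1 h2]; apply: (ins [:: y]) => //=; first by rewrite h1 sym h2.
    by rewrite (negbTE yC1).
  have n2 : ~~ (e x1 z && e x2 z).
    apply/negP=> /andP[h1 h2]; apply: (ins [:: z]) => //=; first by rewrite h1 sym h2.
    by rewrite (negbTE zC1).
  have n3 : ~~ (e x1 y && e x2 z).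
    apply/negP=> /andP[h1 h2]; apply: (ins [:: y; z]) => //=.
    - by rewrite h1 yz sym h2.
    - by rewrite inE nyz.
    - by rewrite (negbTE yC1) (negbTE zC1).
  have n4 : ~~ (e x1 z && e x2 y).
    apply/negP=> /andP[h1 h2]; apply: (ins [:: z; y]) => //=.
    - by rewrite h1 sym yz sym h2.
    - by rewrite inE eq_sym nyz.
    - by rewrite (negbTE yC1) (negbTE zC1).
  have n5 : e x1 y || e x2 z.
    apply: NNPP => /negP/norP[h1 h2]; apply: nolong; rewrite -sz1.
    exact: (merge_switch se uC1 uD dis1 h1 h2).
  have n6 : e x1 z || e x2 y.
    apply: NNPP => /negP/norP[h1 h2]; apply: nolong; rewrite -sz1.
    have E := lastI t (rev q).
    have uD' : ucycle e [:: z, y, t & rev q].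
      have := ucycle_rev sym uD; rewrite 2!rev_cons rev_rcons -!cats1 -catA.
      exact: (@ucycle_catC _ e (t :: rev q) [:: z; y]).
    rewrite E in uD'; apply: (merge_switch se uC1 uD' _ h1 h2); rewrite -E.
    apply: contra dis1 => /hasP[u hu uC']; apply/hasP; exists u => //.
    by move: hu; rewrite !inE mem_rcons !inE mem_rev orbCA.
  (* The six constraints leave one pattern: one of [x1], [x2] is adjacent to both [y] and [z], the
     other to neither. *)
  move: n1 n2 n3 n4 n5 n6; rewrite /b.
  by case: (e x1 y) (e x1 z) (e x2 y) (e x2 z) => [] [] [] [].
have rot1 x1 x2 x3 r (C1 := [:: x1, x2, x3 & r]) : ucycle e C1 -> size C1 = size C -> C1 =i C ->
    exists x4 r', [/\ ucycle e [:: x2, x3, x4 & r'], size [:: x2, x3, x4 & r'] = size C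
                  & [:: x2, x3, x4 & r'] =i C].
  move=> uC1 sz1 mC1.
  have /ucycle_catC uC' : ucycle e ([:: x1] ++ [:: x2, x3 & r]) by [].
  have [x4 [r' E]] : exists x4 r', r ++ [:: x1] = x4 :: r'.
    by case: (r) => [|x4 r']; [exists x1, [::] | exists x4, (r' ++ [:: x1])].
  exists x4, r'; rewrite -E; split=> //; first by rewrite -sz1 /= size_cat addn1.
  by move=> u; rewrite -mC1 !(inE, mem_cat); case: (u == x1); rewrite ?orbT ?orbF.
have [x1 [x2 [x3 [r [uC1 sz1 mC1 bx1]]]]] : exists x1 x2 x3 r, [/\ ucycle e [:: x1, x2, x3 & r],
    size [:: x1, x2, x3 & r] = size C, [:: x1, x2, x3 & r] =i C & b x1].
  case CE: C szC => [|x1 [|x2 [|x3 r]]] // _.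
  have [bx1|nbx1] := boolP (b x1); first by exists x1, x2, x3, r; rewrite -CE.
  have h : [/\ ucycle e [:: x1, x2, x3 & r], size [:: x1, x2, x3 & r] = size C
                  & [:: x1, x2, x3 & r] =i C] by rewrite -CE.
  case: h => h1 h2 h3; have [] := alt _ _ _ _ h1 h2 h3.
  rewrite (negbTE nbx1) /= => bx2 _; have [x4 [r' [k1 k2 k3]]] := rot1 _ _ _ _ h1 h2 h3.
  by exists x2, x3, x4, r'; split=> //; [have := k2; rewrite CE | rewrite -CE].
(* Since [b x1] holds, [b] fails at both [x2] and [x3], which contradicts the alternation along the
   edge [x2 x3]. *)
have [] := alt _ _ _ _ uC1 sz1 mC1; rewrite bx1 /= => nb2 nb3.
have [x4 [r' [uC2 sz2 mC2]]] := rot1 _ _ _ _ uC1 sz1 mC1.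
by have [] := alt _ _ _ _ uC2 sz2 mC2; rewrite (negbTE nb2) (negbTE nb3).
Qed.

(** * Longest paths, and cycles under a minimum degree condition *)

Lemma exists_longest (P : pred (seq T)) s0 : P s0 ->
  (forall s, P s -> uniq s) ->
  exists2 s, P s & forall s', P s' -> size s' <= size s.
Proof.
move=> Ps0 uP; have [n] := ubnP (#|T| - size s0).
elim: n => // n IH in s0 Ps0 *; rewrite ltnS => hn.
have [[s' Ps' lt]|none] := classic (exists2 s', P s' & size s0 < size s').
  apply: (IH s') => //; have := max_card [in s'].
  by rewrite (card_uniqP (uP _ Ps')); clear -hn lt; lia.
by exists s0 => // s' Ps'; rewrite leqNgt; apply/negP=> lt; apply: none; exists s'.
Qed.

Lemma end_cycle e y s t : symmetric e -> path e y s -> uniq (y :: s) ->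
  t \in s -> t != head y s -> e y t ->
  exists D, [/\ ucycle e D, 2 < size D & {subset D <= y :: s}].
Proof.
case: s => [|v s] //= sym /andP[yv pv]; rewrite !inE => un ts tv yt.
rewrite (negbTE tv) /= in ts.
case/splitPr: ts pv un => p q.
rewrite -cat_rcons cat_path => /andP[pv _] /andP[yp vp].
exists (y :: v :: rcons p t); split.
- rewrite /ucycle /= yv rcons_path pv last_rcons sym yt /=.
  move: yp vp; rewrite !inE !mem_cat !negb_or cat_uniq.
  by case/and3P=> -> -> _ /andP[/andP[-> _] /and3P[-> _ _]].
- by rewrite /= size_rcons.
- move=> u; rewrite !inE mem_cat => /or3P[->|->|->] //; by rewrite ?orbT.
Qed.

Lemma next_decomp C x : uniq C -> 2 < size C -> x \in C ->
  exists i r, rot i C = [:: x, next C x, next C (next C x) & r].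
Proof.
move=> uC szC xC; have [i C1 C1E] := rot_to xC.
exists i; have := size_rot i C; have uR : uniq (rot i C) by rewrite rot_uniq.
rewrite -!(next_rot i uC) C1E in uR *.
case: C1 uR {C1E} => [|y [|z r]] uR sz; rewrite -?sz // in szC.
exists r; rewrite [next _ x]/= eqxx /= eq_sym.
by move: uR; rewrite /= inE !negb_or => /andP[/andP[/negbTE-> _] _]; rewrite eqxx.
Qed.

Lemma next_detour e C x s : simple_graph e -> ucycle e C -> 2 < size C ->
  x \in C -> uniq s -> ~~ has [in C] s -> s != [::] ->
  path e x (rcons s (next C x)) -> realizes_longer e (size C).
Proof.
move=> se uC szC xC us dis sn ps.
have [i [r E]] : exists i r, rot i C = [:: x, next C x, next C (next C x) & r].
  by apply: next_decomp => //; case/andP: uC.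
rewrite -(rot_ucycle i) E in uC.
exists (size s + size (next C (next C x) :: r)).+2.
  rewrite -(size_rot i) E /=; case: (s) sn => //= ? ? _; by rewrite addSn !ltnS leq_addl.
apply: (@ucycle_detour_realizes e x [::] (next C x) (next C (next C x) :: r) s) => //.
by rewrite cat0s -E (eq_has (mem_rot i C)).
Qed.

Lemma next2_detour e C x s : simple_graph e -> ucycle e C -> 2 < size C ->
  x \in C -> uniq s -> ~~ has [in C] s -> 1 < size s ->
  path e x (rcons s (next C (next C x))) -> realizes_longer e (size C).
Proof.
move=> se uC szC xC us dis sn ps.
have [i [r E]] : exists i r, rot i C = [:: x, next C x, next C (next C x) & r].
  by apply: next_decomp => //; case/andP: uC.
rewrite -(rot_ucycle i) E in uC.
exists (size s + size r).+2.
  rewrite -(size_rot i) E /=; clear -sn; lia.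
apply: (@ucycle_detour_realizes e x [:: next C x] (next C (next C x)) r s) => //.
by rewrite -E (eq_has (mem_rot i C)).
Qed.

(** The injective successor map sends [U] to a disjoint subset of [C] of the same size. In
    [spread3], excluding distance two as well gives three disjoint copies. *)
Lemma spread2 C (U : {set T}) : uniq C -> {subset U <= C} ->
  {in U, forall x, next C x \notin U} -> #|U| * 2 <= size C.
Proof.
move=> uC UC nU; have ninj : injective (next C) := can_inj (prev_next uC).
rewrite -(card_uniqP uC) muln2 -addnn -{2}(card_imset U ninj) -cardsUI.
rewrite (_ : U :&: _ = set0) ?cards0 ?addn0.
  apply: subset_leq_card; apply/subsetP=> x; rewrite !inE.
  by case/orP=> [/UC//|/imsetP[y /UC yC ->]]; rewrite mem_next.
apply/eqP; rewrite -subset0; apply/subsetP=> x; rewrite !inE.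
by case/andP=> xU /imsetP[y yU xE]; rewrite xE (negbTE (nU _ yU)) in xU.
Qed.

Lemma spread3 C (U : {set T}) : uniq C -> {subset U <= C} ->
  {in U, forall x, next C x \notin U} ->
  {in U, forall x, next C (next C x) \notin U} -> #|U| * 3 <= size C.
Proof.
move=> uC UC nU nnU; have ninj : injective (next C) := can_inj (prev_next uC).
pose V := next C @: U; pose W := next C @: V.
have cV : #|V| = #|U| by apply: card_imset.
have cW : #|W| = #|U| by rewrite -cV; apply: card_imset.
have dUV : [disjoint U & V].
  rewrite disjoint_sym disjoint_subset; apply/subsetP=> x /imsetP[y yU ->]; rewrite inE; exact: nU.
have dUW : [disjoint U & W].
  rewrite disjoint_sym disjoint_subset; apply/subsetP=> x /imsetP[z /imsetP[y yU ->] ->].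
  by rewrite inE; apply: nnU.
have dVW : [disjoint V & W].
  rewrite disjoint_sym disjoint_subset; apply/subsetP=> x /imsetP[z /imsetP[y yU ->] ->].
  by rewrite inE (mem_imset _ _ ninj) nU.
have -> : #|U| * 3 = #|U :|: V :|: W|.
  rewrite !cardsU setIUl (disjoint_setI0 dUV) (disjoint_setI0 dUW).
  by rewrite (disjoint_setI0 dVW) setU0 cards0 cV cW; clear; lia.
rewrite -(card_uniqP uC); apply: subset_leq_card; apply/subsetP=> x; rewrite !inE.
have VC y : y \in V -> y \in C by case/imsetP=> z /UC zC ->; rewrite mem_next.
by case/orP=> [/orP[/UC|/VC]//|/imsetP[z /VC zC ->]]; rewrite mem_next.
Qed.

(** All neighbours of the end of a longest path lie on the path, and one of them is not the next
    vertex. *)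
Lemma exists_cycle e : simple_graph e -> 0 < #|T| -> (forall x, 1 < degree e x) ->
  exists2 C, ucycle e C & 2 < size C.
Proof.
move=> [sym irr] /card_gt0P[x0 _] deg2.
have [||s /andP[us ps] smax] := @exists_longest [pred s | uniq s && sorted e s] [:: x0].
- by [].
- by move=> s /andP[].
case: s us ps smax => [|y s] us ps smax; first by have := smax [:: x0] isT.
have ins t : e y t -> t \in s.
  move=> yt; apply: NNPP => /negP ts.
  have /smax : [pred s | uniq s && sorted e s] [:: t, y & s].
    rewrite /= in us ps *; rewrite us ps sym yt inE negb_or ts !andbT.
    by apply: contraTneq yt => ->; rewrite irr.
  by rewrite ltnn.
have [t yt tn] : exists2 t, e y t & t != head y s.
  apply: NNPP => none; have := deg2 y; rewrite ltnNge => /negP; apply.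
  rewrite -(cards1 (head y s)); apply: subset_leq_card; apply/subsetP=> t.
  by rewrite !inE => yt; apply: NNPP => /negP tn; apply: none; exists t.
by have [D [uD szD _]] := end_cycle sym ps us (ins _ yt) tn yt; exists D.
Qed.

Lemma sorted_rev_sym e s : symmetric e -> sorted e (rev s) = sorted e s.
Proof. by move=> sym; rewrite rev_sorted; apply: eq_sorted => x y; rewrite sym. Qed.

(** The ends of a longest path outside [C] have so many neighbours on [C] that two of these are
    close enough for a detour along the path to lengthen [C]. *)
Lemma cycle_lengthen e m C : simple_graph e -> 1 < m ->
  (forall x, m < degree e x) -> ucycle e C -> 2 < size C -> size C <= m.*2.+1 ->
  size C < #|T| -> realizes_longer e (size C).
Proof.
move=> se m2 deg uC szC szCm szT; apply: NNPP => nolong; have [sym irr] := se.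
have unC : uniq C by case/andP: uC.
have [t0 t0C] : exists t0, t0 \notin C.
  apply: NNPP => none; move: szT; rewrite ltnNge => /negP; apply.
  rewrite -(card_uniqP unC); apply: subset_leq_card; apply/subsetP=> t _.
  by apply: NNPP => /negP tC; apply: none; exists t.
pose P := [pred s | [&& uniq s, sorted e s & ~~ has [in C] s]].
have [||s Ps smax] := @exists_longest P [:: t0].
- by rewrite /= orbF t0C.
- by move=> s /and3P[].
(* An end has at most one neighbour outside [C]: one off the path would extend the path, and one on
   it other than the next vertex would close a cycle disjoint from [C], which can be merged into
   [C]. *)
have endpoint y s' : P (y :: s') -> size (y :: s') = size s ->
    m + (s' == [::]) <= #|[set x in C | e y x]|.
  move=> /and3P[us ps ds] sz.
  have hd t : e y t -> t \notin C -> s' != [::] /\ t = head y s'.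
    move=> yt tC.
    have ts : t \in s'.
      apply: NNPP => /negP ts.
      have /smax : P [:: t, y & s'].
        rewrite /= in us ps ds *; rewrite us ps sym yt inE negb_or ts (negbTE tC) ds !andbT.
        by apply: contraTneq yt => ->; rewrite irr.
      by rewrite -sz ltnn.
    split; first by apply: contraTneq ts => ->.
    apply: NNPP => /eqP tn.
    have [D [uD szD sD]] := end_cycle sym ps us ts tn yt.
    apply: nolong; apply: disjoint_cycle_longer uD szD _ => //.
    by apply: contra ds => /hasP[u /sD us' uC']; apply/hasP; exists u.
  have := deg y; rewrite /degree -(cardsID [set x in C] [set x | e y x]).
  have -> : [set x | e y x] :&: [set x in C] = [set x in C | e y x].
    by apply/setP=> x; rewrite !inE andbC.
  have : #|[set x | e y x] :\: [set x in C]| <= (s' != [::]).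
    case: (eqVneq s' [::]) hd => [->|sn] hd.
      rewrite leqn0 cards_eq0; apply/eqP/setP=> x; rewrite !inE.
      by apply/negP=> /andP[xC /hd/(_ xC)[]].
    rewrite [nat_of_bool _]/= -(cards1 (head y s')).
    apply: subset_leq_card; apply/subsetP=> x.
    by rewrite !inE => /andP[xC /hd/(_ xC)[_ ->]].
  by case: (s' == _); rewrite /= ?addn0 ?addn1; clear; lia.
have det x s' : uniq s' -> ~~ has [in C] s' -> s' != [::] -> x \in C ->
    path e x (rcons s' (next C x)) -> False.
  by move=> us ds sn xC ps; apply: nolong; apply: next_detour ps.
case: s Ps smax endpoint => [|y s] Ps smax endpoint.
  by have := smax [:: t0]; rewrite /= orbF t0C => /(_ isT).
have [us ps ds] := and3P Ps.
have yC : y \notin C by move: ds; rewrite /= negb_or => /andP[].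
pose A := [set x in C | e y x].
have AC : {subset A <= C} by move=> x; rewrite inE => /andP[].
have ey := endpoint _ _ Ps (erefl _); rewrite -/A in ey.
have AA x : x \in A -> next C x \in A -> False.
  rewrite !inE => /andP[xC yx] /andP[_ ynx]; apply: (@det x [:: y]) => //=.
    by rewrite orbF.
  by rewrite sym yx ynx.
(* A path with one vertex has at least [m + 1] neighbours on [C], no two consecutive, so [C] would
   have at least [2m + 2] vertices. *)
have [sE|sn] := eqVneq s [::].
  rewrite sE eqxx in ey; have : #|A| * 2 <= size C.
    by apply: spread2 => // x xA; apply/negP=> /(AA _ xA).
  by clear -ey szCm; lia.
have [s1 [z sE]] : exists s1 z, s = rcons s1 z.
  by case/lastP: s sn {Ps smax endpoint us ps ds ey} => // s1 z _; exists s1, z.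
have revE : rev (y :: s) = z :: rev (y :: s1) by rewrite sE -rcons_cons rev_rcons.
have Pr : P (z :: rev (y :: s1)).
  by rewrite -revE inE rev_uniq sorted_rev_sym // has_rev.
have ez := endpoint _ _ Pr; rewrite -revE size_rev in ez; have {}ez := ez (erefl _).
pose B := [set x in C | e z x]; rewrite -/B in ez.
have zC : z \notin C by move: ds; rewrite sE -rcons_cons has_rcons negb_or => /andP[].
have BC : {subset B <= C} by move=> x; rewrite inE => /andP[].
have BB x : x \in B -> next C x \in B -> False.
  rewrite !inE => /andP[xC yx] /andP[_ ynx]; apply: (@det x [:: z]) => //=.
    by rewrite orbF.
  by rewrite sym yx ynx.
have pAB x w : x \in A -> w \in B -> path e x (rcons (y :: s) w).
  rewrite !inE => /andP[_ yx] /andP[_ zw].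
  have py : path e y s := ps.
  by rewrite rcons_path /= sym yx py sE last_rcons zw.
have AB x : x \in A -> next C x \in B -> False.
  by move=> xA nB; apply: (@det x (y :: s)) => //; [apply: AC | apply: pAB].
have BA x : x \in B -> next C x \in A -> False.
  move=> xB nA; apply: (@det x (rev (y :: s))) => //.
  - by rewrite rev_uniq.
  - by rewrite has_rev.
  - by rewrite revE.
  - exact: BC.
  - exact/(path_rev sym)/pAB.
pose U := A :|: B.
have UC : {subset U <= C} by move=> x; rewrite inE => /orP[/AC|/BC].
have UU : {in U, forall x, next C x \notin U}.
  move=> x; rewrite /U !in_setU => /orP[] h; apply/negP=> /orP[] h'.
  - exact: AA h h'.
  - exact: AB h h'.
  - exact: BA h h'.
  - exact: BB h h'.
have U2 := spread2 unC UC UU.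
have AU : A \subset U by apply: subsetUl.
have BU : B \subset U by apply: subsetUr.
have hA : m <= #|A| by apply: leq_trans ey; apply: leq_addr.
have hB : m <= #|B| by apply: leq_trans ez; apply: leq_addr.
(* No two elements of [U] are consecutive on a cycle of length at most [2m + 1]. Both [A] and [B]
   have at least [m] elements, so they coincide with [U]. *)
have Um : #|U| <= m by clear -U2 szCm; lia.
have AE : A = U by apply/eqP; rewrite eqEcard AU (leq_trans Um).
have BE : B = U by apply/eqP; rewrite eqEcard BU (leq_trans Um).
(* The path has at least two vertices, so it also lengthens [C] between vertices at distance two.
   Then [3m <= 2m + 1], against [1 < m]. *)
have U3 : #|U| * 3 <= size C.
  apply: spread3 => // x xU; apply/negP=> nnU; apply: nolong.
  apply: (@next2_detour e C x (y :: s)) => //; first exact: UC.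
    by rewrite sE /= size_rcons.
  by apply: pAB; rewrite ?AE ?BE.
have : m <= #|U| by rewrite -AE.
by clear -U3 szCm m2; lia.
Qed.

(** Any cycle is lengthened until its length is at least [l], which [l <= m.*2.+2] permits, and then
    shortened one vertex at a time; [4 < l] keeps the shortened cycles long enough for
    [cycle_shorten]. *)
Lemma min_degree_cycle e m l : simple_graph e -> 1 < m ->
  (forall x, m < degree e x) -> 4 < l -> l <= m.*2.+2 -> l <= #|T| ->
  realizes_cycle e l.
Proof.
move=> se m2 deg l5 lm lT.
have [C uC szC] : exists2 C, ucycle e C & 2 < size C.
  by apply: exists_cycle => // [|x]; [clear -l5 lT; lia | apply: ltn_trans (deg x)].
have [n ln rn] : exists2 n, l <= n & realizes_cycle e n.
  have : realizes_cycle e (size C) by exists e, C.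
  have [k] := ubnP (l - size C); elim: k (size C) szC => // k IH n n3 hk rn.
  have [|ltn] := leqP l n; first by exists n.
  have [e' [C' [rw uC' szC']]] := rn.
  have [|||||||n' n'n rn'] := @cycle_lengthen e' m C'.
  - by case: rw.
  - by [].
  - by case: rw => _ d x; rewrite d.
  - by [].
  - by rewrite szC'.
  - by rewrite szC'; clear -ltn lm; lia.
  - by rewrite szC'; apply: leq_trans lT.
  rewrite szC' in n'n; apply: (IH n').
  - by clear -n'n n3; lia.
  - by clear -n'n hk ltn; lia.
  - exact: realizes_cycle_rewires rw rn'.
have [k] := ubnP (n - l); elim: k n ln rn => // k IH n ln rn hk.
move: ln; rewrite leq_eqVlt => /predU1P[-> //|ln].
have [e' [C' [rw uC' szC']]] := rn.
apply: (IH n.-1); [by clear -ln; lia | | by clear -ln hk; lia].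
apply: (realizes_cycle_rewires rw); rewrite -szC'; apply: cycle_shorten => //.
- by case: rw.
- by case: rw => _ d x; rewrite d; apply: leq_ltn_trans (deg x).
- by rewrite szC'; apply: leq_ltn_trans ln.
Qed.

End Lengthening.

(** * Posa's theorem *)

Section Posa.

Variable T : finType.
Implicit Types (e : rel T) (p q s r C D : seq T) (a b c d x y z u v w t : T).

Lemma complete_hamiltonian e : 1 < #|T| -> (forall x y, x != y -> e x y) ->
  ucycle e (enum T).
Proof.
move=> T2 compl; rewrite /ucycle enum_uniq andbT.
have := enum_uniq T; have : 1 < size (enum T) by rewrite -cardE.
case: (enum T) => [|x s] // szs us.
have : cycle [rel x y | x != y] (x :: s).
  rewrite /= rcons_path; apply/andP; split.
    by move: us; rewrite uniq_pairwise => /pairwise_sorted.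
  case: s us szs => // y s us _; apply: contraTneq us => xE.
  by have := mem_last y s; rewrite /= in xE; rewrite xE cons_uniq => ->.
by apply: sub_cycle => u v; apply: compl.
Qed.

(* If [v ... x w ... u] is a Hamiltonian path with [x], [w] consecutive, then the
   edges [x u] and [w v] close it to the Hamiltonian cycle [v ... x u ... w]. *)
Lemma crossing_cycle e e1 C u v x : symmetric e ->
  ucycle e1 C -> next C u = v -> u \in C -> x \in C -> u != x -> ~~ e u v ->
  (forall y z, y != v -> z != v -> e1 y z = e y z) ->
  (forall y z, y != u -> z != u -> e1 y z = e y z) ->
  e v (next C x) -> e u x -> exists2 D, ucycle e D & size D = size C.
Proof.
move=> sym uC uv uC' xC nux nuv ev eu vx ux.
have unC : uniq C by case/andP: uC.
have [i p pE] := rot_to xC.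
have up : u \in p by move: uC'; rewrite -(mem_rot i) pE inE (negbTE nux).
have uR : ucycle e1 (x :: p) by rewrite -pE rot_ucycle.
have szC : size C = size (x :: p) by rewrite -pE size_rot.
rewrite -!(next_rot i unC) pE in uv vx.
case/splitPr: up uR uv vx szC {pE} => p1 p2 uR uv vx szC.
have /andP[cR unR] := uR.
case: p1 uR uv vx szC cR unR => [|w p1] uR uv vx szC cR unR.
  by move: vx; rewrite /= eqxx sym (negbTE nuv).
have wE : next (x :: (w :: p1) ++ u :: p2) x = w by rewrite /= eqxx.
rewrite wE in vx.
have [q vE] : exists q, rcons p2 x = v :: q.
  have : next (u :: rcons p2 x ++ (w :: p1)) u = v.
    have <- : rot (size [:: x, w & p1]) (x :: (w :: p1) ++ u :: p2) = u :: rcons p2 x ++ (w :: p1).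
      by rewrite cat_rcons; apply: (rot_size_cat [:: x, w & p1]).
    by rewrite next_rot.
  by case: (p2) => [|y p2'] /=; rewrite eqxx => <-; [exists [::] | exists (rcons p2' x)].
exists (x :: rev (w :: rcons p1 u) ++ p2); last first.
  by rewrite szC /= size_cat size_rev /= size_rcons size_cat /= addSnnS.
have unM : uniq ((w :: rcons p1 u) ++ v :: q).
  by rewrite -vE -rcons_cat rcons_uniq cat_cons cat_rcons; apply: unR.
have [p1v vqu] : v \notin w :: rcons p1 u /\ u \notin v :: q.
  move: unM; rewrite cat_uniq => /and3P[_ /hasPn h _]; split.
    by apply: h; rewrite inE eqxx.
  by apply/negP=> /h; rewrite /= !inE mem_rcons inE eqxx orbT.
apply/andP; split; last first.
  have /perm_uniq-> : perm_eq (x :: rev (w :: rcons p1 u) ++ p2) (x :: (w :: rcons p1 u) ++ p2).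
    by rewrite perm_cons perm_cat2r perm_rev.
  by rewrite /= cat_rcons.
move: cR; rewrite -cat_rcons /= rcons_cat cat_path last_rcons vE => /and3P[_ pw /andP[_ pv]].
rewrite rev_cons rev_rcons /= rcons_cat cat_path rcons_path last_rcons /= vE /=.
rewrite (sym x u) ux (sym w v) vx /=.
have pw' : path e w (rcons p1 u).
  rewrite -(@eq_in_path _ [pred y | y != v] e1) //.
  by apply/allP=> y yp; apply: contraNneq p1v => <-.
have pv' : path e v q.
  rewrite -(@eq_in_path _ [pred y | y != u] e1) //.
  by apply/allP=> y yp; apply: contraNneq vqu => <-.
rewrite pv' andbT.
by have := path_rev sym pw'; rewrite rcons_path => /andP[-> ->].
Qed.

(** The hypothesis says that fewer than [a] vertices have degree at most [a]. Induction on the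
    number of nonadjacent pairs: join a nonadjacent pair [u], [v] of maximal degree sum. A
    Hamiltonian cycle through the new edge can be rerouted inside [e], unless too many vertices have
    degree at most that of [v]. *)
Theorem posa e : simple_graph e -> 2 < #|T| ->
  (forall a : nat, 0 < a -> a.*2 < #|T| -> #|T| < #|[set x | a < degree e x]| + a) ->
  exists2 C, ucycle e C & size C = #|T|.
Proof.
move=> se T3; have [k] := ubnP #|[set p : T * T | ~~ e p.1 p.2]|.
elim: k => // k IH in e se *; rewrite ltnS => hk hP; have [sym irr] := se.
pose nonadj (p : T * T) := (p.1 != p.2) && ~~ e p.1 p.2.
have [/existsP[p0 np0]|/existsPn none] := boolP [exists p, nonadj p]; last first.
  exists (enum T); last by rewrite -cardE.
  apply: complete_hamiltonian => [|x y xy]; first exact: ltnW.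
  by have := none (x, y); rewrite /nonadj /= xy negbK.
have [u [v [nuv euv dvu dmax]]] : exists u v, [/\ u != v, ~~ e u v,
    degree e v <= degree e u &
    forall x y, x != y -> ~~ e x y -> degree e x + degree e y <= degree e u + degree e v].
  case: (@arg_maxnP _ p0 nonadj (fun p : T * T => degree e p.1 + degree e p.2) np0).
  move=> [u v] /andP[/= nuv euv] dmax.
  have dm x y : x != y -> ~~ e x y -> degree e x + degree e y <= degree e u + degree e v.
    by move=> xy exy; apply: (dmax (x, y)); rewrite /nonadj /= xy.
  have [dvu|duv] := leqP (degree e v) (degree e u); first by exists u, v.
  exists v, u; rewrite eq_sym sym; split=> //; first exact: ltnW.
  by move=> x y xy exy; rewrite [leqRHS]addnC dm.
pose e1 : rel T := fun x y => e x y || (x == u) && (y == v) || (x == v) && (y == u).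
have se1 : simple_graph e1.
  split=> [x y|x]; rewrite /e1.
    by rewrite sym -!orbA; congr (_ || _); rewrite orbC [X in X || _]andbC [X in _ || X]andbC.
  rewrite irr /=; have [->|_] := eqVneq x u; rewrite ?(negbTE nuv) //=.
  by rewrite andbF.
have e1e y z : ~~ ((y == u) && (z == v) || (y == v) && (z == u)) -> e1 y z = e y z.
  by rewrite /e1 -orbA => /negbTE->; rewrite orbF.
have [||C uC szC] := IH e1 se1.
- apply: leq_trans hk; apply: proper_card; apply/properP; split.
    by apply/subsetP=> p; rewrite !inE /e1 !negb_or -andbA => /andP[].
  by exists (u, v); rewrite !inE //= /e1 !eqxx orbT.
- move=> a a0 aT; apply: leq_trans (hP a a0 aT) _; rewrite leq_add2r.
  apply: subset_leq_card; apply/subsetP=> x; rewrite !inE => /leq_trans; apply.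
  by apply: subset_leq_card; apply/subsetP=> y; rewrite !inE /e1 => ->.
have unC : uniq C by case/andP: uC.
have allC x : x \in C.
  have : [set x in C] == [set: T].
    by rewrite eqEcard subsetT cardsT -szC cardsE (card_uniqP unC) leqnn.
  by move/eqP/setP/(_ x); rewrite !inE.
apply: NNPP => noham.
(* A cycle avoiding the new edge would lie in [e]; otherwise [C] or its reversal runs from [u] to
   [v] along it. *)
have [D [uD szD Duv]] : exists D, [/\ ucycle e1 D, size D = #|T| & next D u = v].
  apply: NNPP => nD; apply: noham; exists C => //; rewrite /ucycle unC andbT.
  apply: cycle_from_next => // x xC.
  have := next_cycle (andP uC).1 xC.
  rewrite {1}/e1 => /orP[/orP[//|/andP[/eqP xu /eqP xv]]|/andP[/eqP xv /eqP xu]].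
    by case: nD; exists C; rewrite -xu.
  case: nD; exists (rev C); split; [by apply: ucycle_rev uC; case: se1 | by rewrite size_rev |].
  by rewrite next_rev // -xu prev_next.
have unD : uniq D by case/andP: uD.
have allD x : x \in D.
  have : [set x in D] == [set: T].
    by rewrite eqEcard subsetT cardsT -szD cardsE (card_uniqP unD) leqnn.
  by move/eqP/setP/(_ x); rewrite !inE.
(* The predecessors of the neighbours of [v]. By the crossing argument none is adjacent to [u], so
   [S] and the neighbourhood of [u] are disjoint, and both miss [u]. *)
pose S := [set x | e v (next D x)].
have cS : #|S| = degree e v.
  rewrite -(card_imset _ (can_inj (prev_next unD))); apply: eq_card => y.
  apply/imsetP/idP => [[x]|]; rewrite inE; first by rewrite inE => h ->.
  by move=> vy; exists (prev D y); rewrite ?inE next_prev.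
have uS : u \notin S by rewrite inE Duv irr.
have Sne x : x \in S -> u != x by apply: contraTneq => <-.
have Su x : x \in S -> ~~ e u x.
  move=> xS; apply/negP=> ux; apply: noham; rewrite -szD.
  apply: (@crossing_cycle e e1 D u v x) => //.
  - exact: Sne.
  - by move=> y z yv zv; apply: e1e; rewrite (negbTE yv) (negbTE zv) andbF.
  - by move=> y z yv zv; apply: e1e; rewrite (negbTE yv) (negbTE zv) andbF.
  - by move: xS; rewrite inE.
have hsum : degree e v + degree e u < #|T|.
  rewrite -cS /degree -cardsUI (_ : S :&: _ = set0) ?cards0 ?addn0.
    rewrite -[#|T|]cardsT; apply: proper_card; apply/properP; split; first exact: subsetT.
    by exists u; rewrite ?inE // Duv !irr.
  by apply/setP=> x; rewrite in_setI [x \in set0]inE; apply/negP=> /andP[/Su/negP h]; rewrite inE.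
(* The hypothesis at [a = 1] says that all degrees exceed 1, so [degree e v] is a positive value of
   [a]. *)
have dv1 : 1 < degree e v.
  have := hP 1 isT T3; rewrite addn1 ltnS -cardsT => h.
  have /eqP/setP/(_ v) : [set x | 1 < degree e x] == [set: T] by rewrite eqEcard subsetT h.
  by rewrite !inE.
(* By maximality of the degree sum, each [x] in [S], being nonadjacent to [u], has degree at most
   that of [v]; there are [degree e v] such vertices. *)
have := hP (degree e v); rewrite (ltnW dv1) => /(_ isT).
have -> : (degree e v).*2 < #|T| by apply: leq_trans hsum; rewrite -addnn ltnS leq_add2l.
move=> /(_ isT); rewrite -{2}cS addnC -cardsUI (_ : S :&: _ = set0) ?cards0 ?addn0.
  by rewrite ltnNge max_card.
apply/setP=> x; rewrite in_setI [x \in set0]inE; apply/negP=> /andP[xS].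
by rewrite inE ltnNge -(leq_add2l (degree e u)) dmax ?Sne ?Su.
Qed.

End Posa.

(** * Laying off a vertex *)

Section LayingOff.

Variable T : finType.
Implicit Types (e : rel T) (x y z u v w t : T).

Lemma degree_lt_card e x : irreflexive e -> degree e x < #|T|.
Proof.
move=> irr; rewrite -[#|T|]cardsT; apply: proper_card; apply/properP.
by split; [apply: subsetT | exists x; rewrite ?inE ?irr].
Qed.

(** The Havel-Hakimi exchange: while a neighbour [x] of [v] has smaller degree than a non-neighbour
    [y], a switch puts [y] in its place. The degree sum over the neighbours of [v] grows and is
    bounded. *)
Lemma top_neighbours e v : simple_graph e ->
  exists2 e', rewires e e' &
    forall x y, e' v x -> ~~ e' v y -> y != v -> degree e' y <= degree e' x.
Proof.
move=> se; have [k] := ubnP (\sum_x degree e x - \sum_(x | e v x) degree e x).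
elim: k => // k IH in e se *; rewrite ltnS => hk; have [sym irr] := se.
apply: NNPP => none.
have [x [y [vx nvy yv dxy]]] :
    exists x y, [/\ e v x, ~~ e v y, y != v & degree e x < degree e y].
  apply: NNPP => h; apply: none; exists e => // x y vx vy yv; rewrite leqNgt.
  by apply/negP=> d; apply: h; exists x, y.
have nxy : x != y by apply: contraTneq vx => ->.
(* [y] has more neighbours than [x], and [v] is adjacent to [x] only. *)
have [w [yw nxw wx]] : exists w, [/\ e y w, ~~ e x w & w != x].
  apply: NNPP => h; move: dxy; rewrite ltnNge => /negP; apply.
  have sub : [set w | e y w] :\ x \subset ([set w | e x w] :\ y) :\ v.
    apply/subsetP=> w; rewrite !inE => /andP[wx yw].
    have -> : w != v by apply: contraNneq nvy => <-; rewrite sym.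
    have -> : w != y by apply: contraTneq yw => ->; rewrite irr.
    by apply: NNPP => /negP xw; apply: h; exists w.
  have := subset_leq_card sub; rewrite /degree.
  rewrite (cardsD1 x [set w | e y w]) (cardsD1 y [set w | e x w]).
  rewrite (cardsD1 v ([set w | e x w] :\ y)) !inE (eq_sym v) yv (sym x v) vx (sym x y) /=.
  by clear; lia.
have wv : w != v by apply: contraNneq nvy => <-; rewrite sym.
have rw : rewires e (switch e v x y w).
  by apply: switch_rewires => //; rewrite eq_sym.
apply: none; have [se' d'] := rw.
have [|e' rw' top] := IH _ se'; last by exists e'; first exact: rewires_trans rw rw'.
apply: leq_trans hk.
have dE : \sum_z degree (switch e v x y w) z = \sum_z degree e z.
  by apply: eq_bigr => z _; apply: d'.
have vE z : switch e v x y w v z = e v z (+) (z \in [:: x; y]).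
  rewrite /switch !inE eqxx (eq_sym v y) (negbTE yv).
  have /negbTE-> : v != x by apply: contraTneq vx => ->; rewrite irr.
  by rewrite /= orbF.
have lt : \sum_(z | e v z) degree e z <
          \sum_(z | switch e v x y w v z) degree (switch e v x y w) z.
  under [X in _ < X]eq_bigr => z _ do rewrite d'.
  rewrite (bigD1 x) //= [X in _ < X](bigD1 y) /=; last by rewrite vE !inE eqxx orbT (negbTE nvy).
  rewrite -addSn leq_add // leq_eqVlt; apply/orP; left; apply/eqP.
  apply: eq_bigl => z; rewrite vE !inE.
  have [->|zx] := eqVneq z x; first by rewrite vx andbF.
  have [->|zy] := eqVneq z y; first by rewrite (negbTE nvy).
  by rewrite addbF.
have le : \sum_(z | switch e v x y w v z) degree (switch e v x y w) z <= \sum_x degree e x.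
  by rewrite -dE [leqRHS](bigID (fun z => switch e v x y w v z)) leq_addr.
by rewrite dE; move: lt le; clear; lia.
Qed.

Variable v : T.

Definition delete e : rel {x | x != v} := fun p q => e (val p) (val q).

(** [insub] fails exactly at [v], where the edges of [e] are kept. A rewiring of the graph without
    [v] thus lifts to one of [e]. *)
Definition undelete e (e' : rel {x | x != v}) : rel T := fun x y =>
  if (insub x, insub y) is (Some x', Some y') then e' x' y' else e x y.

Lemma delete_simple e : simple_graph e -> simple_graph (delete e).
Proof. by move=> [sym irr]; split=> [x y | x]; rewrite /delete. Qed.

Lemma degree_delete e (x : {x | x != v}) : symmetric e ->
  degree e (val x) = degree (delete e) x + e v (val x).
Proof.
move=> sym; rewrite /degree (cardsD1 v [set y | _]) inE sym addnC; congr (_ + _).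
rewrite -(card_imset _ val_inj); apply: eq_card => y.
apply/idP/imsetP => [|[z]]; rewrite !inE; last first.
  by move=> xz ->; rewrite (valP z).
by case/andP=> yv xy; exists (Sub y yv); rewrite ?inE.
Qed.

Lemma undelete_val e (e' : rel {x | x != v}) (x y : {x | x != v}) :
  undelete e e' (val x) (val y) = e' x y.
Proof. by rewrite /undelete !valK. Qed.

Lemma undelete_v e (e' : rel {x | x != v}) y : undelete e e' v y = e v y.
Proof. by rewrite /undelete insubF ?eqxx. Qed.

Lemma undelete_vr e (e' : rel {x | x != v}) y : undelete e e' y v = e y v.
Proof. by rewrite /undelete [insub v]insubF ?eqxx //; case: insub. Qed.

Lemma undelete_rewires e (e' : rel {x | x != v}) : simple_graph e ->
  rewires (delete e) e' -> rewires e (undelete e e').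
Proof.
move=> [sym irr] [[sym' irr'] d'].
have vP x : x = v \/ exists x' : {x | x != v}, x = val x'.
  have [->|xv] := eqVneq x v; first by left.
  by right; exists (Sub x xv).
have symU : symmetric (undelete e e').
  move=> x y; have [->|[x' ->]] := vP x; first by rewrite undelete_v undelete_vr sym.
  have [->|[y' ->]] := vP y; first by rewrite undelete_v undelete_vr sym.
  by rewrite !undelete_val.
split; first split=> // x.
  by have [->|[x' ->]] := vP x; rewrite ?undelete_v ?undelete_val.
move=> x; have [->|[x' ->]] := vP x.
  by apply: eq_card => y; rewrite !inE undelete_v.
rewrite !degree_delete // undelete_v -d'; congr (_ + _).
by apply: eq_card => y; rewrite !inE /delete undelete_val.
Qed.

Lemma delete_realizes_cycle e l : simple_graph e ->
  realizes_cycle (delete e) l -> realizes_cycle e l.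
Proof.
move=> se [e' [C [rw /andP[cC uC] szC]]].
exists (undelete e e'), (map val C); split.
- exact: undelete_rewires.
- rewrite /ucycle map_inj_uniq ?uC ?andbT; last exact: val_inj.
  by rewrite cycle_map; rewrite (eq_cycle (e' := e')) // => x y; apply: (@undelete_val e e').
- by rewrite size_map.
Qed.

Lemma card_delete : #|{: {x | x != v}}| = #|T|.-1.
Proof. by rewrite card_sig cardC1. Qed.

Lemma sum_delete e : simple_graph e ->
  \sum_x degree e x = \sum_x degree (delete e) x + (degree e v).*2.
Proof.
move=> [sym irr].
have val_sum (F : T -> nat) : \sum_(x | x != v) F x = \sum_(x : {x | x != v}) F (val x).
  exact: (big_sub [pred x | x != v]).
rewrite (bigD1 v) //= val_sum.
rewrite (eq_bigr _ (fun p _ => degree_delete p sym)) big_split /=.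
rewrite -(val_sum (fun x => e v x : nat)).
have -> : \sum_(x | x != v) e v x = degree e v.
  rewrite /degree -sum1dep_card [RHS](bigID (fun x => x != v)) /=.
  rewrite [X in _ = _ + X]big_pred0 ?addn0; last first.
    by move=> x; rewrite negbK; case: eqP => [->|]; rewrite ?irr ?andbF.
  rewrite [RHS]big_mkcondl /=; apply: eq_bigr => x _; by case: (e v x).
by rewrite -addnn addnC -addnA.
Qed.

End LayingOff.

Arguments delete {T} v e.

(** * The Posa condition under deletion of a vertex, and the induction *)

(** For [delete_posa] when [degree e v <= a]: [A] and [t] count the vertices of degree above [a] and
    above [a.+1], and the left side bounds the degree sum. *)
Lemma posa_sum_low n m a t A : 1 < m -> 0 < a <= m -> m.*2.+1 < n -> A + t < n -> t < a ->
  n * a + A + t * (n - 2 - a) <= m * (2 * n - m - 1).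
Proof.
move=> m2 /andP[a0 am] mn At ta.
have [a' aE] : exists a', a = a'.+1 by exists a.-1; lia.
have [d mE] : exists d, m = a + d by exists (m - a); lia.
have [r nE] : exists r, n = m.*2.+2 + r by exists (n - m.*2.+2); lia.
have h1 : t * (n - 2 - a) = t * (n - 3 - a) + t.
  by rewrite -mulnSr; congr (_ * _); lia.
have h2 : t * (n - 3 - a) <= a' * (n - 3 - a) by rewrite leq_mul2r; lia.
(* The worst case is [t = a - 1] with [A = n - 1 - t]. *)
apply: (@leq_trans (n * a + a' * (n - 3 - a) + n.-1)); first by lia.
have -> : 2 * n - m - 1 = 3 * m + 3 + 2 * r by lia.
have -> : n - 3 - a = m + d + r - 1 by lia.
have [q qE] : exists q, m + d + r = q.+1 by exists (m + d + r).-1; lia.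
rewrite qE subn1 /=.
suff : n * a + a' * (m + d + r) + n + d * (2 * m + d + 2 + 2 * r) + m = 
  m * (3 * m + 3 + 2 * r) + a' + 3.
  rewrite qE mulnS; move: m2 mn; clear.
  by move: (d * _) (m * _) (n * a) (a' * q) => X M Y Z; lia.
by rewrite nE mE aE; clear; lia.
Qed.

(** For [delete_posa] when [a < degree e v]: all [n] degrees exceed [a], and at most one exceeds
    [a.+1]. *)
Lemma posa_sum_high n m a t : 1 < m -> a < m -> m.*2.+1 < n -> t <= 1 ->
  n * a + n + t * (n - 2 - a) <= m * (2 * n - m - 1).
Proof.
move=> m2 am mn t1.
have [d mE] : exists d, m = a + d.+1 by exists (m - a.+1); lia.
have [r nE] : exists r, n = m.*2.+2 + r by exists (n - m.*2.+2); lia.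
have [q qE] : exists q, m = q.+1 by exists m.-1; lia.
have h : t * (n - 2 - a) <= 1 * (n - 2 - a) by rewrite leq_mul2r t1 orbT.
rewrite mul1n in h.
apply: (@leq_trans (n * a + n + (n - 2 - a))); first by lia.
have -> : 2 * n - m - 1 = 3 * m + 3 + 2 * r by lia.
suff : n * a + n + n + (q * (q + 2) + r * q + d * (2 * m + 1 + r)) =
  m * (3 * m + 3 + 2 * r) + 2 + a
    by move: m2 mn am; clear; move: (_ + d * _) (m * _) (n * a) => X M Y; lia.
have qd : q = a + d by lia.
by rewrite nE qE qd; clear; lia.
Qed.

(* Laying off [v] can only destroy the Posa condition when all but few degrees
   are at most [a.+1], and then the degree sum is too small. *)
Lemma delete_posa (T : finType) (e : rel T) (v : T) (m l a : nat) :
  simple_graph e -> 1 < m -> m.*2 < l -> l < #|T| ->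
  (forall x, degree e v <= degree e x) -> degree e v <= m ->
  (forall x y, e v x -> ~~ e v y -> y != v -> degree e y <= degree e x) ->
  m * (2 * #|T| - m - 1) < \sum_x degree e x ->
  0 < a <= m -> l < #|[set x | a < degree e x]| + a ->
  l < #|[set x | a < degree (delete v e) x]| + a.
Proof.
move=> se m2 ml lT vmin dm top hS /andP[a0 am] hA; have [sym irr] := se.
rewrite ltnNge; apply/negP=> hA'; move: hS; rewrite ltnNge => /negP; apply.
pose A := [set x | a < degree e x]; pose H := [set x | a.+1 < degree e x].
pose A' := [set x | a < degree (delete v e) x].
pose B := [set x | e v x & degree e x == a.+1].
rewrite -/A in hA; rewrite -/A' in hA'.
(* A vertex other than [v] that drops out of [A] is a neighbour of [v] of degree exactly [a.+1]. *)
have cA : #|A| <= #|A'| + #|B| + (a < degree e v).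
  have sub : A :\ v \subset val @: A' :|: B.
    apply/subsetP=> x; rewrite !inE => /andP[xv]; rewrite -[x]/(val (Sub x xv : {x | x != v})).
    move: (Sub _ _) => {xv}x; rewrite degree_delete // => ax.
    have [a'x|a'x] := ltnP a (degree (delete v e) x).
      by rewrite imset_f ?inE.
    case: (e v (val x)) ax => ax; last by rewrite addn0 ltnNge a'x in ax.
    by apply/orP; right; rewrite addn1 ltnS in ax *; rewrite eqSS eqn_leq a'x.
  rewrite (cardsD1 v A) inE [X in _ <= X]addnC leq_add2l.
  apply: leq_trans (subset_leq_card sub) _; rewrite cardsU.
  by apply: leq_trans (leq_subr _ _) _; rewrite (card_imset _ val_inj).
(* Neighbours of [v] have the largest degrees, so one of degree [a.+1] forces all of [H] into the
   neighbourhood of [v]. *)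
have cH : 0 < #|B| -> degree e v <= a.+1 -> #|H| + #|B| <= degree e v.
  case/card_gt0P=> b; rewrite inE => /andP[vb /eqP db] dv.
  rewrite -cardsUI (_ : H :&: B = set0) ?cards0 ?addn0.
    apply: subset_leq_card; apply/subsetP=> x; rewrite !inE.
    case/orP=> [ax|/andP[]//]; apply: NNPP => /negP vx.
    have xv : x != v by apply: contraTneq ax => ->; rewrite -leqNgt.
    by have := top b x vb vx xv; rewrite db leqNgt ax.
  by apply/setP=> x; rewrite !inE; case: eqP => [->|]; rewrite ?ltnn ?andbF.
have hS : \sum_x degree e x <= #|T| * a + #|A| + #|H| * (#|T| - 2 - a).
  have ind (S : {set T}) : \sum_x (x \in S : nat) = #|S|.
    by rewrite -sum1_card [RHS]big_mkcond /=; apply: eq_bigr => x _; case: (x \in S).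
  rewrite -(ind A) -(ind H) -sum_nat_const big_distrl -!big_split /=.
  apply: leq_sum => x _; rewrite /A /H !inE; have := degree_lt_card x irr.
  by move: (degree e x) => d; move: #|T| => n; clear; case: ltnP; case: ltnP; lia.
apply: leq_trans hS _.
have [av|av] := ltnP a (degree e v); last first.
  rewrite ltnNge av addn0 in cA.
  have B0 : 0 < #|B| by move: hA hA' cA; clear; lia.
  have cH0 := cH B0 (leqW av).
  apply: posa_sum_low => //; rewrite ?a0 //; [by clear -ml lT; lia | | by clear -cH0 B0 av; lia].
  by clear -hA' cA cH0 av lT; lia.
have AT : #|A| = #|T|.
  rewrite -cardsT; congr #|pred_of_set _|; apply/setP=> x; rewrite !inE.
  exact: leq_trans (vmin x).
rewrite av AT in cA hA *.
have B0 : 0 < #|B| by move: hA hA' cA lT a0; clear; lia.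
have dv : degree e v <= a.+1.
  by case/card_gt0P: B0 => b; rewrite inE => /andP[_ /eqP<-].
(* Here [B] has at least [a] elements and [degree e v <= a.+1], so [H] has at most one. *)
have cH0 := cH B0 dv; apply: posa_sum_high => //.
- exact: leq_trans av dm.
- by clear -ml lT; lia.
- by clear -hA' cA lT dv cH0; lia.
Qed.

Theorem posa_realizes_cycle (m l : nat) (T : finType) (e : rel T) :
  1 < m -> m.*2 < l <= m.*2.+2 -> l <= #|T| -> simple_graph e ->
  (forall a, 0 < a <= m -> l < #|[set x | a < degree e x]| + a) ->
  m * (2 * #|T| - m - 1) < \sum_x degree e x -> realizes_cycle e l.
Proof.
move=> m2 /andP[ml lm]; have [k] := ubnP #|T|.
elim: k T e => // k IH T e; rewrite ltnS => hk lT se hP hS.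
have l5 : 4 < l by clear -m2 ml; lia.
move: lT; rewrite leq_eqVlt => /predU1P[lE|lT].
  (* From [2a < l <= 2m + 2] follows [a <= m], so the hypothesis covers every [a] that is needed. *)
  have [|a a0 aT|C uC szC] := posa se.
  - by clear -l5 lE; lia.
  - by rewrite -lE; apply: hP; rewrite a0; clear -aT lE lm; lia.
  by exists e, C; rewrite lE.
have [x0 _] : exists x0 : T, x0 \in T by apply/card_gt0P; exact: leq_ltn_trans lT.
have [v _ vmin] := @arg_minnP _ x0 predT (degree e) isT.
have [dm|dm] := leqP (degree e v) m; last first.
  apply: min_degree_cycle (m2) _ l5 lm (ltnW lT) => // x.
  by apply: leq_trans dm _; apply: vmin.
have [e' rw top] := top_neighbours v se; have [se' d'] := rw.
apply: (realizes_cycle_rewires rw); apply: delete_realizes_cycle => //.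
have sE : \sum_x degree e' x = \sum_x degree e x by apply: eq_bigr => z _; apply: d'.
apply: IH; rewrite ?card_delete.
- by clear -hk lT; lia.
- by clear -lT; lia.
- exact: delete_simple.
- move=> a am; apply: (@delete_posa T e' v m l a) => //.
  + by move=> x; rewrite !d'; apply: vmin.
  + by rewrite d'.
  + by rewrite sE.
  + by under eq_finset => x do rewrite d'; apply: hP.
have := sum_delete v se'; rewrite sE d' => E; rewrite E in hS.
move: hS dm lT ml; clear; move: (\sum_x _) (degree e v) => s d hS dm lT ml.
(* The bound drops by [2m], the degree sum only by twice the degree of [v], which is at most [m]. *)
have : m * (2 * #|T| - m - 1) = m * (2 * #|T|.-1 - m - 1) + m.*2.
  by rewrite -muln2 -mulnDr; congr (_ * _); lia.
by lia.
Qed.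

(** * Degree sums *)

(* The degree sum of K_a + (K_(l-2a) u (n-l+a) K_1). *)
Definition threshold_sum (l n a : nat) : nat :=
  (l - a) * (l - a - 1) + 2 * a * (n - (l - a)).

Lemma threshold_sum_convex l n m a : 0 < a <= m -> m.*2 < l -> l <= n ->
  threshold_sum l n a <= maxn (threshold_sum l n 1) (threshold_sum l n m).
Proof.
move=> /andP[a0 am] ml ln.
have [b aE] : exists b, a = b.+1 by exists a.-1; lia.
have [c mE] : exists c, m = a + c by exists (m - a); lia.
have [p lE] : exists p, l = m + p.+1 by exists (l - m - 1); lia.
have [r nE] : exists r, n = l + r by exists (n - l); lia.
have gaE : threshold_sum l n a = (c + p).+1 * (c + p) + 2 * a * (r + a).
  by rewrite /threshold_sum; congr (_ * _ + _ * _); lia.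
have g1E : threshold_sum l n 1 = (b + c + p).+1 * (b + c + p) + 2 * (r + 1).
  by rewrite /threshold_sum; congr (_ * _ + _ * _); lia.
have gmE : threshold_sum l n m = p.+1 * p + 2 * m * (r + m).
  by rewrite /threshold_sum; congr (_ * _ + _ * _); lia.
rewrite leqNgt gtn_max; apply/negP=> /andP[lt1 ltm].
(* The sum is quadratic in [a] with leading coefficient 3, and [a] is the mean of [m] and 1 with
   weights [b = a - 1] and [c = m - a]; the last term is the convexity gap. *)
have conv : b * threshold_sum l n m + c * threshold_sum l n 1 =
    (b + c) * threshold_sum l n a + 3 * (b * c * (b + c)).
  by rewrite gaE g1E gmE mE aE; clear; lia.
have h1 : c * (threshold_sum l n 1).+1 <= c * threshold_sum l n a by rewrite leq_mul2l lt1 orbT.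
have hm : b * (threshold_sum l n m).+1 <= b * threshold_sum l n a by rewrite leq_mul2l ltm orbT.
rewrite !mulnS mulnDl in h1 hm conv.
have [b0|b0] := posnP b; last first.
  by move: h1 hm conv b0; clear; move: (b * _) (b * _) (c * _) (c * _) (3 * _) => *; lia.
by rewrite aE b0 ltnn in lt1.
Qed.

Lemma threshold_sum_even l n a : odd (threshold_sum l n a) = false.
Proof.
rewrite /threshold_sum oddD !oddM /= addbF.
by case: (l - a) => // k; rewrite subn1 /= andNb.
Qed.

(** This and the next three evaluations give the closed forms of the extremal sums [a = m] and
    [a = 1] for both parities of [l]. *)
Lemma threshold_sum_odd_max m n : m.*2.+1 <= n ->
  threshold_sum (2 * m + 1) n m = m * (2 * n - m - 1).
Proof.
move=> mn; have [r nE] : exists r, n = m.*2.+1 + r by exists (n - m.*2.+1); lia.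
have -> : 2 * n - m - 1 = 3 * m + 1 + 2 * r by lia.
rewrite /threshold_sum; have -> : 2 * m + 1 - m = m.+1 by lia.
have -> : n - m.+1 = m + r by lia.
by rewrite subn1 /=; lia.
Qed.

Lemma threshold_sum_even_max m n : m.*2.+2 <= n ->
  threshold_sum (2 * m + 2) n m = m * (2 * n - m - 1) + 2.
Proof.
move=> mn; have [r nE] : exists r, n = m.*2.+2 + r by exists (n - m.*2.+2); lia.
have -> : 2 * n - m - 1 = 3 * m + 3 + 2 * r by lia.
rewrite /threshold_sum; have -> : 2 * m + 2 - m = m.+2 by lia.
have -> : n - m.+2 = m + r by lia.
by rewrite subn1 /=; lia.
Qed.

Lemma threshold_sum_odd1 m n : 1 < m -> m.*2.+1 <= n ->
  threshold_sum (2 * m + 1) n 1 = 2 * n + 4 * m ^ 2 - 6 * m.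
Proof.
move=> m2 mn; have [r nE] : exists r, n = m.*2.+1 + r by exists (n - m.*2.+1); lia.
rewrite /threshold_sum addnK; have -> : n - 2 * m = r.+1 by lia.
have [q qE] : exists q, m = q.+1 by exists m.-1; lia.
have -> : 2 * m - 1 = q.*2.+1 by lia.
have sE : m ^ 2 = q * q + q.*2 + 1 by rewrite qE -mulnn; lia.
by rewrite sE nE qE; clear; lia.
Qed.

Lemma threshold_sum_even1 m n : 1 < m -> m.*2.+2 <= n ->
  threshold_sum (2 * m + 2) n 1 = 2 * n + 4 * m ^ 2 - 2 * m - 2.
Proof.
move=> m2 mn; have [r nE] : exists r, n = m.*2.+2 + r by exists (n - m.*2.+2); lia.
rewrite /threshold_sum; have -> : 2 * m + 2 - 1 = m.*2.+1 by lia.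
have -> : n - m.*2.+1 = r.+1 by lia.
rewrite -mulnn subn1 /=; have : m <= m * m by rewrite leq_pmulr //; lia.
by rewrite nE; clear; lia.
Qed.

(** * Degree sums that force the Posa condition *)

Lemma superset_card (T : finType) (A : {set T}) k : #|A| <= k <= #|T| ->
  exists2 B : {set T}, A \subset B & #|B| = k.
Proof.
move=> /andP[Ak kT]; have [d] := ubnP (k - #|A|).
elim: d => // d IH in A Ak *; rewrite ltnS => hd.
move: Ak; rewrite leq_eqVlt => /predU1P[Ak|Ak]; first by exists A.
have [x xA] : exists x, x \notin A.
  apply: NNPP => none; move: (leq_trans Ak kT); rewrite -cardsT ltnNge => /negP; apply.
  by apply: subset_leq_card; apply/subsetP=> x _; apply: NNPP => /negP xA; apply: none; exists x.
have cA : #|x |: A| = #|A|.+1 by rewrite cardsU1 xA.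
have [||B AB cB] := IH (x |: A); rewrite ?cA //; first by clear -hd Ak; lia.
by exists B => //; apply: subset_trans AB; apply: subsetUr.
Qed.

(** The degrees outside [S] sum to at most [a] per vertex, and the edges leaving [S] contribute at
    most the same amount again to the degrees inside [S]. *)
Lemma degree_sum_le (T : finType) (e : rel T) (S : {set T}) a : simple_graph e ->
  (forall x, x \notin S -> degree e x <= a) ->
  \sum_x degree e x <= #|S| * (#|S| - 1) + 2 * a * (#|T| - #|S|).
Proof.
move=> [sym irr] low.
have degE x : degree e x = \sum_(y in S) e x y + \sum_(y in ~: S) e x y.
  rewrite /degree -sum1dep_card [LHS]big_mkcond [LHS](bigID [in S]) /=; congr (_ + _).
  by apply: eq_big => [y|y _]; rewrite ?inE //; case: (e x y).
have lowS : \sum_(x in ~: S) degree e x <= a * (#|T| - #|S|).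
  have -> : #|T| - #|S| = #|~: S| by rewrite [RHS]cardsCs setCK.
  rewrite mulnC -sum_nat_const; apply: leq_sum => x; rewrite inE; exact: low.
have inS : \sum_(x in S) \sum_(y in S) e x y <= #|S| * (#|S| - 1).
  rewrite -sum_nat_const; apply: leq_sum => x xS.
  rewrite (bigD1 x) //= irr add0n (cardsD1 x S) xS addKn -sum1_card.
  rewrite (eq_bigl [in S :\ x]) => [|y]; last by rewrite !inE andbC.
  by apply: leq_sum => y _; apply: leq_b1.
have outS : \sum_(x in S) \sum_(y in ~: S) e x y <= \sum_(y in ~: S) degree e y.
  rewrite exchange_big /=; apply: leq_sum => y _; rewrite degE.
  by rewrite (eq_bigr (fun x => e y x : nat)) ?leq_addr // => x _; rewrite sym.
have cE : \sum_(x | x \notin S) degree e x = \sum_(x in ~: S) degree e x.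
  by apply: eq_bigl => x; rewrite inE.
rewrite (bigID [in S]) /= cE.
have -> : \sum_(x in S) degree e x =
    \sum_(x in S) \sum_(y in S) e x y + \sum_(x in S) \sum_(y in ~: S) e x y.
  by rewrite -big_split /=; apply: eq_bigr => x _.
rewrite -mulnA mul2n -addnn addnA; apply: leq_add => //; apply: leq_add => //.
exact: leq_trans lowS.
Qed.

Lemma sum_posa (T : finType) (e : rel T) l m a : simple_graph e ->
  0 < a <= m -> m.*2 < l -> l <= #|T| ->
  maxn (threshold_sum l #|T| 1) (threshold_sum l #|T| m) < \sum_x degree e x ->
  l < #|[set x | a < degree e x]| + a.
Proof.
move=> se am ml lT; rewrite ltnNge => hS; rewrite ltnNge; apply: contra hS => hA.
apply: leq_trans (threshold_sum_convex am ml lT).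
(* If the condition fails at [a], at most [l - a] degrees exceed [a]; padding to exactly [l - a]
   vertices makes the bound equal to [threshold_sum]. *)
have [|S AS cS] := @superset_card T [set x | a < degree e x] (l - a).
  by move: hA am ml lT; clear; lia.
rewrite /threshold_sum -cS; apply: degree_sum_le => // x xS.
by rewrite leqNgt; apply: contra xS => ax; apply: (subsetP AS); rewrite inE.
Qed.

(** * Threshold sequences *)

Lemma card_ord_lt n k : k <= n -> #|[set i : 'I_n | i < k]| = k.
Proof.
move=> kn; have winj : injective (widen_ord kn) by move=> i j [] /val_inj.
rewrite -[RHS]card_ord -(card_imset _ winj).
apply: eq_card => i; rewrite inE; apply/idP/imsetP => [ik|[j _ ->] //=].
by exists (Ordinal ik) => //; apply: val_inj.
Qed.

Section Threshold.

Variables n l a : nat.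
Hypotheses (a0 : 0 < a) (al : a.*2 < l) (ln : l <= n).

(** The three ranges are the dominating vertices, the middle clique and the low vertices, in order
    of decreasing degree. *)
Definition threshold_degree (i : nat) : nat :=
  if i < a then n - 1 else if i < l - a then l - a - 1 else a.

Definition threshold_seq : n.-tuple nat := [tuple threshold_degree i | i < n].

Definition threshold_graph : rel 'I_n := fun i j =>
  (i != j) && [|| i < a, j < a | (i < l - a) && (j < l - a)].

Lemma threshold_realization : realization threshold_seq threshold_graph.
Proof.
split; first split.
- by move=> i j; rewrite /threshold_graph eq_sym orbCA [(i < _) && _]andbC.
- by move=> i; rewrite /threshold_graph eqxx.
move=> i; rewrite tnth_mktuple /degree /threshold_degree /threshold_graph.
have D1 (S : {set 'I_n}) : i \in S -> #|S :\ i| = #|S| - 1.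
  by move=> iS; rewrite (cardsD1 i S) iS addKn.
case: ltnP => [ia|ai].
  rewrite (_ : [set j | _] = [set: 'I_n] :\ i); first by rewrite D1 ?inE // cardsT card_ord.
  by apply/setP=> j; rewrite !inE eq_sym /= andbT.
case: ltnP => [il|li].
  rewrite (_ : [set j | _] = [set j : 'I_n | j < l - a] :\ i).
    by rewrite D1 ?inE // card_ord_lt //; lia.
  apply/setP=> j; rewrite !inE eq_sym /=; congr (_ && _).
  by case: ltnP => // ja; apply/esym; lia.
rewrite (_ : [set j | _] = [set j : 'I_n | j < a]); first by rewrite card_ord_lt //; lia.
apply/setP=> j; rewrite !inE /= orbF; case: ltnP => ja; rewrite ?andbF // andbT.
by apply: contraTneq ja => <-; rewrite -leqNgt.
Qed.

Lemma threshold_seq_sum : sumn threshold_seq = threshold_sum l n a.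
Proof.
rewrite sumnE big_map big_enum /=.
have ind k : k <= n -> \sum_(i < n) (i < k : nat) = k.
  move=> kn; rewrite -[RHS](card_ord_lt kn) -sum1dep_card [RHS]big_mkcond /=.
  by apply: eq_bigr => i _; case: (i < k).
(* Each degree is [a] plus the jumps at [l - a] and at [a]. *)
have -> : \sum_(i < n) threshold_degree i =
  \sum_(i < n) (a + (i < l - a) * (l - a.*2 - 1) + (i < a) * (n - (l - a))).
  apply: eq_bigr => i _; rewrite /threshold_degree.
  by case: ltnP => ?; case: ltnP => ?; lia.
rewrite !big_split /= sum_nat_const card_ord -!big_distrl /= !ind; [|lia|lia].
have [p lE] : exists p, l = a + p.+1 by exists (l - a - 1); lia.
have [r nE] : exists r, n = p.+1 + r by exists (n - p.+1); lia.
have [q pE] : exists q, p = a + q by exists (p - a); lia.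
rewrite /threshold_sum; have -> : l - a = p.+1 by lia.
have -> : l - a.*2 - 1 = q by lia.
have -> : n - p.+1 = r by lia.
by rewrite subn1 /= nE pE; clear; lia.
Qed.

Lemma threshold_GS : GS threshold_seq.
Proof.
have seqE : threshold_seq = map threshold_degree (iota 0 n) :> seq nat.
  by rewrite -val_enum_ord -map_comp.
split; first by exists threshold_graph; apply: threshold_realization.
- rewrite seqE; apply: (homo_sorted (e := leq)); last exact: iota_sorted.
  move=> i j ij; rewrite /geq /= /threshold_degree.
  case: (ltnP i a) => ?; case: (ltnP j a) => ?; case: (ltnP i (l - a)) => ?;
    by case: (ltnP j (l - a)) => ?; lia.
- rewrite seqE; have [n' nE] : exists n', n = n'.+1 by exists n.-1; lia.
  by rewrite nE /= /threshold_degree a0 nE subn1.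
Qed.

(* In any realization, the [a] dominating vertices are the only neighbours of
   the [n - l + a] low ones. On a cycle of length [l], the successor map sends
   the (at least [a]) low vertices onto the dominating ones, hence it preserves
   the set of middle vertices. *)
Lemma threshold_not_potentially : ~ potentially_cycle_graphic l threshold_seq.
Proof.
move=> [e [[[sym irr] dE] [_ [C [/andP[cC uC] szC]]]]].
pose U := [set i : 'I_n | i < a]; pose L := [set i : 'I_n | i < l - a].
have cU : #|U| = a by apply: card_ord_lt; lia.
have cL : #|L| = l - a by apply: card_ord_lt; lia.
have dom (i j : 'I_n) : i < a -> i != j -> e i j.
  move=> ia ij; have : [set y | e i y] == [set~ i].
    rewrite eqEcard; apply/andP; split.
      by apply/subsetP=> y; rewrite !inE => iy; apply: contraTneq iy => ->; rewrite irr.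
    have := dE i; rewrite tnth_mktuple /threshold_degree ia /degree => ->.
    by rewrite cardsC1 card_ord subn1.
  by move=> /eqP/setP/(_ j); rewrite !inE eq_sym ij.
have low (i j : 'I_n) : l - a <= i -> e i j -> j < a.
  move=> li ij; have : U == [set y | e i y].
    rewrite eqEcard cU; apply/andP; split.
      apply/subsetP=> y; rewrite !inE => ya; rewrite sym; apply: dom => //.
      by apply: contraTneq ya => ->; rewrite -leqNgt; lia.
    have := dE i; rewrite tnth_mktuple /threshold_degree /degree => ->.
    by case: ltnP => [?|_]; [lia | case: ltnP => // ?; lia].
  by move=> /eqP/setP/(_ j); rewrite !inE ij => ->.
have ninj : injective (next C) := can_inj (prev_next uC).
have nC i : i \in C -> e i (next C i) by apply: next_cycle.
pose W := [set i in C] :\: L.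
have cC' : #|[set i in C]| = l by rewrite cardsE (card_uniqP uC).
have WU : next C @: W \subset U.
  apply/subsetP=> j /imsetP[i]; rewrite !inE -leqNgt => /andP[li iC] ->.
  exact: low (nC _ iC).
have cW : #|W| <= a by rewrite -cU -(card_imset _ ninj); apply: subset_leq_card.
have cE := cardsID L [set i in C]; rewrite -/W cC' in cE.
(* At most [a] of the [l] cycle vertices are low and [L] has only [l - a] elements, so both counts
   are attained. *)
have LC : [set i in C] :&: L = L.
  by apply/eqP; rewrite eqEcard subsetIr cL; lia.
have WE : next C @: W = U.
  by apply/eqP; rewrite eqEcard WU cU (card_imset _ ninj); move: cE; rewrite LC cL; lia.
have inC (i : 'I_n) : i < l - a -> i \in C.
  move=> il; have : i \in L by rewrite inE.
  by rewrite -LC !inE => /andP[].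
(* Each dominating vertex already succeeds a low one, and a low vertex has only dominating
   neighbours. *)
have midn (i : 'I_n) : a <= i < l - a -> a <= next C i < l - a.
  move=> /andP[ai il]; have ein := nC i (inC i il); rewrite ltnNge leqNgt.
  apply/andP; split; apply/negP=> h.
    have : next C i \in U by rewrite inE.
    by rewrite -WE (mem_imset _ _ ninj) !inE il.
  by rewrite sym in ein; have := low _ _ h ein; rewrite ltnNge ai.
have an : a < n by lia.
have n0 : 0 < n by lia.
(* [z] is a middle vertex, since [a < l - a], and [u] is dominating. Both lie on the cycle, so
   iterating the successor from [z] must reach [u], yet it never leaves the middle. *)
pose z := Ordinal an; pose u := Ordinal n0.
have zC : z \in C by apply: inC => /=; lia.
have uC' : u \in C by apply: inC => /=; lia.
have : fconnect (next C) z u by rewrite (fconnect_cycle (cycle_next uC)).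
move/iter_findex; move: (findex _ _ _) => k kE.
have mid : a <= iter k (next C) z < l - a.
  by elim: k {kE} => [|k IH] /=; [lia | exact: midn].
by move: mid; rewrite kE /= leqNgt a0.
Qed.

End Threshold.

(** * The potential number from both bounds *)

(** Above the maximum, the degree sum yields both hypotheses of [posa_realizes_cycle]; the threshold
    sequence attaining the maximum shows that no smaller even number works. *)
Lemma is_potential_number_threshold m l n : 1 < m -> m.*2 < l <= m.*2.+2 -> l <= n ->
  m * (2 * n - m - 1) <= threshold_sum l n m ->
  is_potential_number l n (maxn (threshold_sum l n 1) (threshold_sum l n m) + 2).
Proof.
move=> m2 lm ln hm; have /andP[ml _] := lm.
have max_even : odd (maxn (threshold_sum l n 1) (threshold_sum l n m)) = false.
  by case: leqP => _; apply: threshold_sum_even.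
split.
- by rewrite oddD max_even.
- move=> d [[e [se de]] _ _] hs.
  have sE : sumn d = \sum_i degree e i.
    rewrite sumnE big_tuple.
    by apply: eq_bigr => i _; rewrite de.
  have cn : #|'I_n| = n by apply: card_ord.
  have [|||e' [C [[se' de'] uC szC]]] := @posa_realizes_cycle m l _ e m2 lm _ se.
  + by rewrite cn.
  + move=> a am; apply: sum_posa am ml _ _ => //; rewrite cn // -sE.
    by apply: leq_trans hs; rewrite addn2.
  + rewrite cn -sE; apply: leq_trans hs; rewrite addn2 ltnS; apply: leqW.
    by apply: leq_trans hm _; apply: leq_maxr.
  exists e'; split; first by split=> // i; rewrite de'.
  by split; [lia | exists C].
- move=> s' es' forces; rewrite leqNgt; apply/negP=> lt.
  (* The maximum is even, so an even number below the maximum plus 2 cannot exceed the maximum. *)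
  have le : s' <= maxn (threshold_sum l n 1) (threshold_sum l n m).
    rewrite leqNgt; apply/negP=> lt'.
    have s'E : s' = (maxn (threshold_sum l n 1) (threshold_sum l n m)).+1 by lia.
    by rewrite s'E /= max_even in es'.
  have no a : 0 < a -> a.*2 < l -> s' <= threshold_sum l n a -> False.
    move=> a0 al sa; apply: (threshold_not_potentially a0 al ln).
    apply: forces; first exact: threshold_GS.
    by rewrite threshold_seq_sum.
  move: le; rewrite leq_max => /orP[]; apply: no => //; lia.
Qed.

Theorem theorem1p4 (m : nat) (hm : 2 <= m) :
  (forall n : nat, 2 * m + 1 <= n ->
     is_potential_number (2 * m + 1) n
       (maxn (2 * n + 4 * m ^ 2 - 6 * m) (m * (2 * n - m - 1)) + 2)) /\
  (forall n : nat, 2 * m + 2 <= n ->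
     is_potential_number (2 * m + 2) n
       (maxn (2 * n + 4 * m ^ 2 - 2 * m - 2) (m * (2 * n - m - 1) + 2) + 2)).
Proof.
split=> n hn.
  have mn : m.*2.+1 <= n by lia.
  rewrite -threshold_sum_odd1 // -threshold_sum_odd_max //.
  by apply: is_potential_number_threshold; rewrite ?threshold_sum_odd_max //; lia.
have mn : m.*2.+2 <= n by lia.
rewrite -threshold_sum_even1 // -threshold_sum_even_max //.
by apply: is_potential_number_threshold; rewrite ?threshold_sum_even_max ?leq_addr //; lia.
Qed.
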